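(* Let $(\Gamma,q)$ be a polarized metrized graph of genus $g\ge1$, written as a successive pointed sum (gluing at single points) of connected subgraphs $\Gamma_1,\dots,\Gamma_m$, each of which is either $2$-edge connected or an edge all of whose interior points are smooth. For each $i$ and $A\in\Gamma_i$ let $\Gamma_A$ be the closure of the connected component of $A$ in $\Gamma\setminus(\Gamma_i\setminus\{A\})$ and $q_i(A)=\sum_{x\in\Gamma_A}q(x)+b_1(\Gamma_A)$. Then each $(\Gamma_i,q_i)$ is a polarized metrized graph of genus $g$, and $$\epsilon(\Gamma)=\sum_i\epsilon(\Gamma_i,q_i),\quad\tau(\Gamma)=\sum_i\tau(\Gamma_i,q_i),\quad\varphi(\Gamma)=\sum_i\varphi(\Gamma_i,q_i),\quad\lambda(\Gamma)=\sum_i\lambda(\Gamma_i,q_i).$$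
   Context: A polarized metrized graph: connected metrized graph $\Gamma$ with $q:\Gamma\to\mathbb Z_{\ge0}$ of finite support such that $K=\sum_x(v(x)+2q(x)-2)x$ is effective ($v(x)$ the valence); genus $g=\sum q(x)+b_1(\Gamma)$. A point is smooth if it is not in the support of $K$. $2$-edge connected: removing any smooth point leaves the graph connected. Admissible measure $\mu=\frac1g(\sum q(x)\delta_x+\sum_e dx_e/(\ell_e+r_e))$, $r_e$ the effective resistance between the endpoints of edge $e$ in $\Gamma\setminus e$ ($\infty$ if disconnected). $r(x,y)$ effective resistance; $\ell(\Gamma)$ total length. Invariants: $\tau(\Gamma)=\frac12\iint r(x,y)d\mu(x)d\mu(y)$; $G(x,x)=\int r(x,y)d\mu(y)-\tau(\Gamma)$; $\epsilon(\Gamma)=\int G(x,x)((2g-2)d\mu+\delta_K)$ $(=\iint r(x,y)\delta_K(x)d\mu(y))$; $\varphi(\Gamma)=-\frac14\ell(\Gamma)+\frac14\int G(x,x)((10g+2)d\mu-\delta_K)$; $\lambda(\Gamma)=\frac{g-1}{6(2g+1)}\varphi(\Gamma)+\frac1{12}(\epsilon(\Gamma)+\ell(\Gamma))$. *)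

(* Defs.v *)
From HB Require Import structures.
From Stdlib Require Import Relation_Operators.
From mathcomp Require Import all_boot all_order all_algebra.
From mathcomp Require Import all_classical all_reals all_analysis.

Set Implicit Arguments.
Unset Strict Implicit.
Unset Printing Implicit Defensive.

Import Order.TTheory GRing.Theory Num.Theory.
Import numFieldNormedType.Exports.

Local Open Scope classical_set_scope.
Local Open Scope ring_scope.

(* A metrized graph is presented by a finite model: a finite multigraph (loops
   and multiple edges allowed) with edge lengths.  The vertex and edge sets are
   subsets of ambient finite types, so that a graph, its subgraphs and
   Gamma \ e all live in the same type.  Vertices of valence 2 are allowed;
   hence every subgraph of the metric space Gamma is a union of vertices and
   edges of some model. *)
Record mgraph (R : realType) (V E : finType) := MGraph {
  verts : {set V};
  edges : {set E};
  src : E -> V;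
  tgt : E -> V;
  len : E -> R
}.

Section MetrizedGraphs.
Variables (R : realType) (V E : finType).
Implicit Types (G H : mgraph R V E).

(* [inl v] is the vertex v; [inr (e, t)] is the point in the interior of the
   edge e at distance t from src e, for 0 < t < len e. *)
Definition gpoint : Type := (V + E * R)%type.

Definition pts G : set gpoint := [set p | match p with
  | inl v => v \in verts G
  | inr (e, t) => (e \in edges G) && (0 < t < len G e)
  end].

Definition pt G (e : E) (t : R) : gpoint :=
  if t <= 0 then inl (src G e)
  else if len G e <= t then inl (tgt G e)
  else inr (e, t).

Definition well_formed G : Prop := forall e, e \in edges G ->
  [/\ src G e \in verts G, tgt G e \in verts G & 0 < len G e].

Definition segment_in G (S : set gpoint) (p p' : gpoint) : Prop :=
  exists (e : E) (s t : R), [/\ e \in edges G, [/\ 0 <= s, s <= t & t <= len G e],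
    p = pt G e s, p' = pt G e t & forall u : R, s <= u <= t -> S (pt G e u)].

(* p and p' are the ends of a piecewise linear path inside S. *)
Definition joined G (S : set gpoint) : gpoint -> gpoint -> Prop :=
  clos_refl_sym_trans gpoint (segment_in G S).

(* Subsets of a metrized graph are connected iff they are path connected; the
   empty set counts as connected. *)
Definition connected_in G (S : set gpoint) : Prop :=
  forall p p', S p -> S p' -> joined G S p p'.

Definition connected_mgraph G : Prop :=
  [/\ well_formed G, pts G !=set0 & connected_in G (pts G)].

(* Topological closure in Gamma, computed on the closed edges. *)
Definition closure_in G (S : set gpoint) : set gpoint :=
  S `|` [set p | exists (e : E) (t : R), [/\ e \in edges G, 0 <= t <= len G e, p = pt G e t
    & closure [set u : R | 0 <= u <= len G e /\ S (pt G e u)] t]].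

(* The cellular boundary Q^edges -> Q^V (acting on row vectors);
   H_1(Gamma, Q) is its kernel. *)
Definition boundary G : 'M[rat]_(#|edges G|, #|V|) :=
  \matrix_(i, j) ((tgt G (enum_val i) == enum_val j)%:R
                  - (src G (enum_val i) == enum_val j)%:R).

Definition b1 G : nat := \rank (kermx (boundary G)).

(* A loop at v contributes 2. *)
Definition valence G (p : gpoint) : nat := match p with
  | inl v => #|[set e in edges G | src G e == v]%SET|
             + #|[set e in edges G | tgt G e == v]%SET|
  | inr _ => 2
  end.

Definition canonical_div G (q : gpoint -> nat) (x : gpoint) : int :=
  (valence G x)%:Z + 2 * (q x)%:Z - 2.

Definition genus G (q : gpoint -> nat) : nat :=
  (\big[addn/0%N]_(x \in pts G) q x + b1 G)%N.

Definition polarized G (q : gpoint -> nat) : Prop :=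
  [/\ connected_mgraph G,
      finite_set [set x | pts G x /\ q x <> 0%N]
    & forall x, pts G x -> 0 <= canonical_div G q x].

Definition smooth G (q : gpoint -> nat) (x : gpoint) : Prop :=
  canonical_div G q x = 0.

(* Effective resistance.  Making the points of the list X vertices cuts the
   edge e at the parameters [breaks X e], each piece [s, t] being a resistor of
   resistance t - s. *)
Definition breaks G (X : seq gpoint) (e : E) : seq R :=
  sort <=%R (undup [:: 0, len G e &
    pmap (fun x : gpoint => match x with
            | inr (e', t) => if e' == e then Some t else None
            | inl _ => None
            end) X]).

Definition pieces G (X : seq gpoint) (e : E) : seq (R * R) :=
  zip (breaks G X e) (behead (breaks G X e)).

(* The net current leaving p, i.e. the coefficient at p of the Laplacian of f,
   for the potential f. *)
Definition current G (X : seq gpoint) (f : gpoint -> R) (p : gpoint) : R :=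
  \sum_(e in edges G) \sum_(st <- pieces G X e)
    ((pt G e st.1 == p)%:R - (pt G e st.2 == p)%:R)
    * ((f (pt G e st.1) - f (pt G e st.2)) / (st.2 - st.1)).

Definition unit_potential G (x y : gpoint) (f : gpoint -> R) : Prop :=
  forall p, current G [:: x; y] f p = (p == x)%:R - (p == y)%:R.

(* If x and y lie in different components, there is no unit potential and the
   value is +oo; otherwise f x - f y does not depend on f. *)
Definition eresistance G (x y : gpoint) : \bar R :=
  xget +oo%E [set r | exists2 f, unit_potential G x y f & r = (f x - f y)%:E].

Definition resistance G (x y : gpoint) : R := fine (eresistance G x y).

Definition del_edge G (e : E) : mgraph R V E :=
  MGraph (verts G) (edges G :\ e)%SET (src G) (tgt G) (len G).

Definition edge_resistance G (e : E) : \bar R :=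
  eresistance (del_edge G e) (inl (src G e)) (inl (tgt G e)).

(* The signed measure
   sum_x (atom x) delta_x + sum_e (dens e) dx_e, where atom has finite support
   on Gamma. *)
Record gmeasure := GMeasure { atom : gpoint -> R; dens : E -> R }.

Definition addm (m1 m2 : gmeasure) : gmeasure :=
  GMeasure (fun x => atom m1 x + atom m2 x) (fun e => dens m1 e + dens m2 e).

Definition scalem (c : R) (m : gmeasure) : gmeasure :=
  GMeasure (fun x => c * atom m x) (fun e => c * dens m e).

Definition gintegral G (m : gmeasure) (f : gpoint -> R) : R :=
  \sum_(x \in pts G) (atom m x * f x)
  + \sum_(e in edges G)
      dens m e * \int[lebesgue_measure]_(t in `[0, len G e]) f (pt G e t).

Definition admissible G (q : gpoint -> nat) : gmeasure :=
  scalem ((genus G q)%:R)^-1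
    (GMeasure (fun x => (q x)%:R)
              (fun e => match edge_resistance G e with
                 | EFin r => (len G e + r)^-1
                 | _ => 0
                 end)).

Definition delta_K G (q : gpoint -> nat) : gmeasure :=
  GMeasure (fun x => (canonical_div G q x)%:~R) (fun=> 0).

Definition total_length G : R := \sum_(e in edges G) len G e.

Definition tau G q : R :=
  2^-1 * gintegral G (admissible G q) (fun x =>
           gintegral G (admissible G q) (fun y => resistance G x y)).

(* x |-> G(x, x) *)
Definition green_diag G q (x : gpoint) : R :=
  gintegral G (admissible G q) (fun y => resistance G x y) - tau G q.

Definition epsilon G q : R :=
  let g : R := (genus G q)%:R in
  gintegral G (addm (scalem (2 * g - 2) (admissible G q)) (delta_K G q))
    (green_diag G q).

Definition phi G q : R :=
  let g : R := (genus G q)%:R in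
  - (4^-1 * total_length G)
  + 4^-1 * gintegral G
      (addm (scalem (10 * g + 2) (admissible G q)) (scalem (-1) (delta_K G q)))
      (green_diag G q).

Definition lambda G q : R :=
  let g : R := (genus G q)%:R in
  (g - 1) / (6 * (2 * g + 1)) * phi G q
  + 12^-1 * (epsilon G q + total_length G).

Definition subgraph H G : Prop :=
  [/\ (verts H \subset verts G)%SET, (edges H \subset edges G)%SET
    & forall e, e \in edges H ->
        [/\ src H e = src G e, tgt H e = tgt G e & len H e = len G e]].

(* Smoothness is that of points of the ambient polarized graph (G, q). *)
Definition two_edge_connected G q H : Prop :=
  forall x, pts H x -> smooth G q x -> connected_in H (pts H `\ x).

Fixpoint walk H (u : V) (s : seq (E * V)) : bool :=
  if s is (e, v) :: s' then
    [&& e \in edges H,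
        ((src H e == u) && (tgt H e == v)) || ((src H e == v) && (tgt H e == u))
      & walk H v s']
  else true.

(* H is an arc from u to w; it may consist of several edges of the model. *)
Definition is_arc H (u w : V) : Prop := exists s : seq (E * V),
  [/\ s <> [::], walk H u s, uniq (u :: unzip2 s), last u (unzip2 s) = w
    & verts H =i u :: unzip2 s /\ edges H =i unzip1 s].

Definition smooth_edge G q H : Prop := exists u w : V, is_arc H u w /\
  forall x, pts H x -> x <> inl u -> x <> inl w -> smooth G q x.

(* H_0, H_0 v H_1, (H_0 v H_1) v H_2, ...: each new piece meets the union of
   the previous ones in exactly one point. *)
Definition successive_pointed_sum G (m : nat) (H : 'I_m -> mgraph R V E) : Prop :=
  \bigcup_i pts (H i) = pts G /\
  forall i : 'I_m, (0 < i)%N -> exists A : gpoint,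
    (\bigcup_(j in [set j : 'I_m | (j < i)%N]) pts (H j)) `&` pts (H i) = [set A].

(* Gamma_A, as a set of points. *)
Definition branch G H (A : gpoint) : set gpoint :=
  closure_in G [set p | joined G (pts G `\` (pts H `\` [set A])) A p].

(* The subgraph of G formed by the vertices and edges contained in S. *)
Definition subgraph_of G (S : set gpoint) : mgraph R V E :=
  MGraph [set v in verts G | `[< S (inl v) >]]%SET
         [set e in edges G | `[< forall t : R, 0 < t < len G e -> S (inr (e, t)) >]]%SET
         (src G) (tgt G) (len G).

Definition induced_q G (q : gpoint -> nat) H (A : gpoint) : nat :=
  (\big[addn/0%N]_(x \in branch G H A) q x + b1 (subgraph_of G (branch G H A)))%N.

End MetrizedGraphs.

Arguments gpoint : clear implicits.

(* Main.v *)
(** The pieces are glued in a tree-like pattern, so each piece [H i] comes with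
    a retraction of G onto it which is constant on every other piece, and
    the branch of G at a point A of [H i] is the fibre of that retraction.

    Effective resistances are read off the Dirichlet form: a unit potential for
    (x, y) represents the functional h |-> h x - h y.  Composing the potentials
    of the pieces with the retractions gives a potential on G, whence
    r(x, y) is the sum of the r_i(pi_i x, pi_i y).

    Foster's theorem (sum over the edges of len / (len + r_e) = b_1) shows that
    the admissible measure of [H i] is the image of that of G, and a count of
    vertices and edges shows the same for the canonical divisor.  In particular
    the induced canonical divisor is effective.  Each invariant is the integral
    of a function that splits as a sum of functions pulled back from the
    pieces, which gives the additivity. *)
Require Import Defs.
From Stdlib Require Import Relation_Operators.
From mathcomp Require Import all_boot all_order all_algebra.
From mathcomp Require Import all_classical all_reals all_analysis.
From mathcomp Require Import ring lra zify.
Import Order.TTheory GRing.Theory Num.Theory.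
Import numFieldNormedType.Exports.
Set Implicit Arguments.
Unset Strict Implicit.
Unset Printing Implicit Defensive.
Local Open Scope classical_set_scope.
Local Open Scope ring_scope.

(** * Dirichlet form and effective resistance *)

Section DirichletForm.
Variables (R : realType) (V E : finType).
Implicit Types (G H : mgraph R V E) (x y p : gpoint R V E) (X : seq (gpoint R V E)).

(** The admissible measure has a continuous part, so resistances are needed between interior points
    of edges, whereas linear algebra only handles the vertices of the model. The passage is an
    explicit Green function: a vertex Green function interpolated linearly in both variables, plus
    on each edge the Green function of the segment with grounded ends. It provides unit potentials
    between any two points, and its Lipschitz bounds along edges, uniform in the other point, make
    the integrands of the iterated integrals integrable.

    The number b_1(Gamma_A) in q_i(A) is a mass in disguise. The retraction onto Gamma_i collapses
    each edge e of Gamma_A to A, and with it the mass len / (len + r_e), where r_e is taken in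
    Gamma. Since r_e is not changed by what hangs off Gamma_A, Foster's theorem for Gamma_A alone
    shows that these masses add up to b_1(Gamma_A). *)

Lemma mem_zip_behead (T : eqType) (a : T) (l : seq T) st :
  st \in zip (a :: l) l -> st.1 \in a :: l /\ st.2 \in l.
Proof.
move=> uv; split.
  have := map_f fst uv => ui; apply: mem_subseq ui.
  by elim: l a {uv} => //= c l IH b; rewrite eqxx; exact: IH.
by have := map_f snd uv; rewrite -/(unzip2 _) unzip2_zip //= leqnSn.
Qed.

Lemma path_lt_ge (s a : R) (l : seq R) : path <%R a l -> s \in a :: l -> a <= s.
Proof.
rewrite inE lt_path_sortedE => /andP[/allP al _] /predU1P[->//|/al].
exact: ltW.
Qed.

(* The potentials on an edge are combinations of the functions [t |-> min t s],
   whose slope is 1 before s and 0 after it. *)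
Lemma sum_zip_min (h : R -> R) (s a : R) (l : seq R) :
  path <%R a l -> s \in a :: l ->
  \sum_(st <- zip (a :: l) l)
     (h st.1 - h st.2) * ((Num.min st.1 s - Num.min st.2 s) / (st.2 - st.1))
  = h s - h a.
Proof.
elim: l a => [|b l IH] a /=; first by rewrite big_nil inE => _ /eqP ->; rewrite subrr.
case/andP=> ab pbl; rewrite inE big_cons /= => /predU1P[->|sl].
  rewrite minxx (min_r (ltW ab)) subrr mul0r mulr0 subrr add0r big_seq big1 // => st.
  case/mem_zip_behead=> s1 s2.
  rewrite !min_r ?subrr ?mul0r ?mulr0 // (le_trans (ltW ab)) // (path_lt_ge pbl) //.
  by rewrite inE s2 orbT.
rewrite IH //.
have bs : b <= s by exact: path_lt_ge pbl sl.
rewrite !min_l ?(le_trans (ltW ab) bs) // -[a - b]opprB mulNr divff; last by rewrite subr_eq0 gt_eqF.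
by rewrite mulrN1; ring.
Qed.

Lemma mem_breaks G X (e : E) (t : R) :
  (t \in breaks G X e) = [|| t == 0, t == len G e | inr (e, t) \in X].
Proof.
rewrite /breaks mem_sort mem_undup !inE; congr [|| _, _ | _].
rewrite mem_pmap; apply/mapP/idP => [[[v|[e' t']] xX]|xX].
- by [].
- by case: eqP xX => // -> xX [->].
- by exists (inr (e, t)) => //; rewrite eqxx.
Qed.

Definition on_graph G X := forall x, x \in X -> pts G x.

Lemma breaks_in_edge G X (e : E) (t : R) : on_graph G X -> 0 <= len G e ->
  t \in breaks G X e -> 0 <= t <= len G e.
Proof.
move=> GX le0; rewrite mem_breaks => /or3P[/eqP->|/eqP->|/GX /= /andP[_ /andP[t0 tl]]].
- by rewrite lexx le0.
- by rewrite lexx le0.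
- by rewrite !ltW.
Qed.

(** Points of the graph have their parameters inside the edge, so 0 is the least break. *)
Lemma breaks_cons G X (e : E) : on_graph G X -> 0 <= len G e ->
  exists l, breaks G X e = 0 :: l /\ path <%R 0 l.
Proof.
move=> GX le0.
have srt : sorted <%R (breaks G X e).
  by rewrite lt_sorted_uniq_le sort_uniq undup_uniq /= sort_sorted//; exact: le_total.
case Eb : (breaks G X e) srt => [|a l] srt.
  have : (0 : R) \in breaks G X e by rewrite mem_breaks eqxx.
  by rewrite Eb.
have a0 : 0 <= a.
  by have /andP[] : 0 <= a <= len G e by apply: (breaks_in_edge GX) => //; rewrite Eb mem_head.
have : (0 : R) \in a :: l by rewrite -Eb mem_breaks eqxx.
rewrite inE => /predU1P[za|zl]; first by move: srt; rewrite -za => srt; exists l.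
move: srt; rewrite /= lt_path_sortedE => /andP[/allP/(_ _ zl)].
by rewrite ltNge a0.
Qed.

Lemma pieces_min G X (e : E) (h : R -> R) (s : R) : on_graph G X -> 0 <= len G e ->
  s \in breaks G X e ->
  \sum_(st <- pieces G X e)
     (h st.1 - h st.2) * ((Num.min st.1 s - Num.min st.2 s) / (st.2 - st.1))
  = h s - h 0.
Proof.
move=> GX le0; have [l [El pl]] := breaks_cons GX le0.
by rewrite /pieces El; exact: sum_zip_min.
Qed.

Lemma mem_pieces G X (e : E) st : st \in pieces G X e ->
  st.1 \in breaks G X e /\ st.2 \in breaks G X e.
Proof.
rewrite /pieces; case: (breaks G X e) => [//|a l] /mem_zip_behead[-> s2].
by rewrite inE s2 orbT.
Qed.

Definition dform G X (h f : gpoint R V E -> R) : R :=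
  \sum_(e in edges G) \sum_(st <- pieces G X e)
    (h (pt G e st.1) - h (pt G e st.2))
    * ((f (pt G e st.1) - f (pt G e st.2)) / (st.2 - st.1)).

Lemma dform_sym G X h f : dform G X h f = dform G X f h.
Proof. by apply: eq_bigr => e _; apply: eq_bigr => st _; ring. Qed.

(** Testing against every h, not only against Dirac functions, is the form in which potentials can
    be composed with retractions. *)
Definition weak_unit_potential G x y f :=
  forall h, dform G [:: x; y] h f = h x - h y.

Lemma weak_unit_potentialW G x y f : weak_unit_potential G x y f -> unit_potential G x y f.
Proof. by move=> wf p; rewrite [p == x]eq_sym [p == y]eq_sym -(wf (fun z => (z == p)%:R)). Qed.

(** Summation by parts. The type of points is infinite, so h is expanded in Dirac functions over a
    finite list P that contains the ends of all pieces. *)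
Lemma dform_current G X (P : seq (gpoint R V E)) h f : uniq P ->
  (forall e st, e \in edges G -> st \in pieces G X e ->
     (pt G e st.1 \in P) /\ (pt G e st.2 \in P)) ->
  dform G X h f = \sum_(p <- P) h p * current G X f p.
Proof.
move=> uP HP; pose delta z p : R := (z == p)%:R.
have hsum z : z \in P -> h z = \sum_(p <- P) h p * delta z p.
  move=> zP; rewrite (bigD1_seq z) //= /delta eqxx mulr1 big1 ?addr0 // => p.
  by rewrite eq_sym => /negPf ->; rewrite mulr0.
rewrite /current; under [RHS]eq_bigr do rewrite mulr_sumr.
rewrite [RHS]exchange_big; apply: eq_bigr => e eG /=.
under [RHS]eq_bigr do rewrite mulr_sumr.
rewrite [RHS]exchange_big [LHS]big_seq [RHS]big_seq; apply: eq_bigr => st stP /=.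
have [P1 P2] := HP e st eG stP.
rewrite (hsum _ P1) (hsum _ P2) -sumrB mulr_suml; apply: eq_bigr => p _.
by rewrite -mulrBr -mulrA.
Qed.

Lemma unit_potential_weak G x y f : unit_potential G x y f -> weak_unit_potential G x y f.
Proof.
move=> uf h.
pose ends e := flatten [seq [:: pt G e st.1; pt G e st.2] | st <- pieces G [:: x; y] e].
(* x and y are included because h x - h y has to be recovered from the Dirac functions of P. *)
pose P := undup (x :: y :: flatten [seq ends e | e <- enum (edges G)]).
rewrite (dform_current (P := P)) ?undup_uniq //; last first.
  move=> e st eG stP; rewrite !mem_undup !inE; split; apply/orP; right; apply/orP; right;
    apply/flattenP; (eexists; first by (apply/mapP; exists e; rewrite ?mem_enum));
    apply/flattenP; (eexists; first by (apply/mapP; exists st)); by rewrite !inE eqxx ?orbT.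
have dsum z : z \in P -> \sum_(p <- P) h p * (p == z)%:R = h z.
  move=> zP; rewrite (bigD1_seq z) ?undup_uniq //= eqxx mulr1 big1 ?addr0 // => p.
  by move=> /negPf ->; rewrite mulr0.
under eq_bigr => p _ do rewrite uf mulrBr.
by rewrite sumrB !dsum // mem_undup !inE eqxx ?orbT.
Qed.

(* Reciprocity: by symmetry of the form, the potential drop of one unit
   potential is computed by any other one, so it does not depend on it. *)
Lemma eresistanceE G x y f : weak_unit_potential G x y f ->
  eresistance G x y = (f x - f y)%:E.
Proof.
move=> wf; rewrite /eresistance; case: xgetP => [r -> [f' uf' ->]|noex]; last first.
  by case: (noex (f x - f y)%:E); exists f => //; exact: weak_unit_potentialW.
by rewrite -(unit_potential_weak uf' f) dform_sym wf.
Qed.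

Lemma resistanceE G x y f : weak_unit_potential G x y f -> resistance G x y = f x - f y.
Proof. by move=> /eresistanceE; rewrite /resistance => ->. Qed.

End DirichletForm.

(** * Vertex potentials and Foster's theorem *)

Section VertexPotentials.
Variables (R : realType) (V E : finType).
Implicit Types (G H : mgraph R V E) (x y p : gpoint R V E) (g h f : V -> R).

Definition venergy G h f : R :=
  \sum_(e in edges G) (h (src G e) - h (tgt G e)) * ((f (src G e) - f (tgt G e)) / len G e).

Lemma venergy_sym G h f : venergy G h f = venergy G f h.
Proof. by apply: eq_bigr => e _; ring. Qed.

Definition vpotential G (u v : V) f := forall h, venergy G h f = h u - h v.

Lemma vpotential_unique G u v f f' : vpotential G u v f -> vpotential G u v f' ->
  f u - f v = f' u - f' v.
Proof. by move=> pf pf'; rewrite -(pf' f) venergy_sym pf. Qed.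

Lemma venergyDr G h f f' : venergy G h (f \+ f') = venergy G h f + venergy G h f'.
Proof. by rewrite /venergy -big_split; apply: eq_bigr => e _ /=; ring. Qed.

Lemma venergyZr G h f (a : R) : venergy G h (a \*o f) = a * venergy G h f.
Proof. by rewrite /venergy mulr_sumr; apply: eq_bigr => e _ /=; ring. Qed.

Lemma venergyBr G h f f' : venergy G h (f \- f') = venergy G h f - venergy G h f'.
Proof. by rewrite /venergy -sumrB; apply: eq_bigr => e _ /=; ring. Qed.

(* Connectedness in elimination form. *)
Definition vconnected G := forall c : V -> bool,
  (forall e, e \in edges G -> c (src G e) = c (tgt G e)) ->
  {in verts G &, forall u v, c u = c v}.

Lemma vconnected_eq G (T : eqType) (c : V -> T) : vconnected G ->
  (forall e, e \in edges G -> c (src G e) = c (tgt G e)) ->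
  {in verts G &, forall u v, c u = c v}.
Proof.
move=> cG ce u v uG vG; apply/eqP.
have := cG (fun w => c u == c w) _ u v uG vG; rewrite eqxx => <- // e eG.
by rewrite ce.
Qed.

Lemma venergy0_const G f : well_formed G -> venergy G f f = 0 ->
  forall e, e \in edges G -> f (src G e) = f (tgt G e).
Proof.
move=> wfG E0 e eG; have [_ _ le0] := wfG e eG.
have F0 e' : e' \in edges G ->
    0 <= (f (src G e') - f (tgt G e')) * ((f (src G e') - f (tgt G e')) / len G e').
  by move=> e'G; have [_ _ l0] := wfG _ e'G; rewrite mulrA divr_ge0 ?(ltW l0) // -expr2 sqr_ge0.
have /eqP := E0; rewrite /venergy psumr_eq0 // => /allP/(_ e (mem_index_enum e)).
rewrite eG /= mulrA mulf_eq0 invr_eq0 (gt_eqF le0) orbF mulf_eq0 orbb subr_eq0.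
by move/eqP.
Qed.

Definition laplacian G : 'M[R]_#|V| :=
  \matrix_(i, j) venergy G (fun v => (v == enum_val i)%:R) (fun v => (v == enum_val j)%:R).

Lemma sum_delta (S : pzRingType) (g : V -> S) (v : V) :
  \sum_(i < #|V|) g (enum_val i) * (v == enum_val i)%:R = g v.
Proof.
rewrite (bigD1 (enum_rank v)) //= enum_rankK eqxx mulr1 big1 ?addr0 // => i.
by case: (v =P enum_val i) => [->|_]; rewrite ?enum_valK ?eqxx ?mulr0.
Qed.

Lemma venergy_laplacian G h f :
  venergy G h f = \sum_(i < #|V|) \sum_(j < #|V|) h (enum_val i) * laplacian G i j * f (enum_val j).
Proof.
under eq_bigr => i _ do under eq_bigr => j _ do rewrite mxE mulr_sumr mulr_suml.
under eq_bigr => i _ do rewrite exchange_big.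
rewrite exchange_big /=; apply: eq_bigr => e _.
rewrite -{1}(sum_delta h (src G e)) -{1}(sum_delta h (tgt G e)).
rewrite -{1}(sum_delta f (src G e)) -{1}(sum_delta f (tgt G e)) -!sumrB.
rewrite !mulr_suml; apply: eq_bigr => i _; rewrite mulr_sumr; apply: eq_bigr => j _.
by ring.
Qed.

(** Fredholm alternative: a column c of the cokernel of the Laplacian is harmonic, hence of zero
    energy and constant on the connected graph. It therefore kills w, the difference of the Dirac
    functions at u and v, which must lie in the row space. *)
Lemma exists_vpotential G (u v : V) : well_formed G -> vconnected G ->
  u \in verts G -> v \in verts G -> exists f, vpotential G u v f.
Proof.
move=> wfG cG uG vG.
pose w : 'rV[R]_#|V| := \row_j ((u == enum_val j)%:R - (v == enum_val j)%:R).
suff /submxP [D wD] : (w <= laplacian G)%MS.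
  exists (fun v => D 0 (enum_rank v)) => h.
  rewrite venergy_sym venergy_laplacian exchange_big /=.
  rewrite -(sum_delta h u) -(sum_delta h v) -sumrB; apply: eq_bigr => j _.
  rewrite -mulr_suml -mulrBr mulrC; congr (_ * _).
  have /matrixP/(_ 0 j) := wD; rewrite !mxE => ->.
  by apply: eq_bigr => i _; rewrite enum_valK.
rewrite submxE; apply/eqP/matrixP => i k; rewrite ord1 !mxE {i}.
pose c v := cokermx (laplacian G) (enum_rank v) k.
have Lc i : \sum_j laplacian G i j * c (enum_val j) = 0.
  have /matrixP/(_ i k) := mulmx_coker (laplacian G); rewrite !mxE => {2}<-.
  by apply: eq_bigr => j _; rewrite /c enum_valK.
have Ec : venergy G c c = 0.
  rewrite venergy_laplacian big1 // => i _.
  by under eq_bigr => j _ do rewrite -mulrA; rewrite -mulr_sumr Lc mulr0.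
have cuv := vconnected_eq cG (venergy0_const wfG Ec) uG vG.
have -> : \sum_j w 0 j * cokermx (laplacian G) j k = c u - c v; last by rewrite cuv subrr.
rewrite -(sum_delta c u) -(sum_delta c v) -sumrB; apply: eq_bigr => j _.
by rewrite -mulrBr mulrC [w 0 j]mxE /c enum_valK.
Qed.

Lemma exists_green G : well_formed G -> vconnected G -> verts G != finset.set0 ->
  exists (k : V -> V -> R) (z : V), forall u, u \in verts G -> vpotential G u z (k u).
Proof.
move=> wfG cG /set0Pn[z zG].
have : forall u, exists f, u \in verts G -> vpotential G u z f.
  move=> u; case: (boolP (u \in verts G)) => uG; last by exists (fun=> 0).
  by have [f pf] := exists_vpotential wfG cG uG zG; exists f.
by move/choice => [k Hk]; exists k, z.
Qed.

Lemma rank_kermxD (F : fieldType) (m n : nat) (A : 'M[F]_(m, n)) : (\rank (kermx A) + \rank A = m)%N.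
Proof. by rewrite mxrank_ker subnK // rank_leq_row. Qed.

Lemma sum_deltal (S : pzRingType) (g : V -> S) (v : V) :
  \sum_(i < #|V|) (v == enum_val i)%:R * g (enum_val i) = g v.
Proof.
rewrite (bigD1 (enum_rank v)) //= enum_rankK eqxx mul1r big1 ?addr0 // => i.
by case: (v =P enum_val i) => [->|_]; rewrite ?enum_valK ?eqxx ?mul0r.
Qed.

(** The row space of the boundary is the space of divisors of degree 0 on [verts G], with basis the
    v - z (the rows of D). The row of an edge is a difference of such vectors; conversely, a
    functional that kills every edge is constant on the vertices, by connectedness, and so kills
    every v - z. *)
Lemma rank_boundary G z : well_formed G -> vconnected G -> z \in verts G ->
  \rank (boundary G) = #|(verts G :\ z)%SET|.
Proof.
move=> wfG cG zG; set W := (verts G :\ z)%SET.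
pose D : 'M[rat]_(#|W|, #|V|) :=
  \matrix_(i, j) ((enum_val i == enum_val j)%:R - (z == enum_val j)%:R).
have rD : \rank D = #|W|.
  apply/eqP; apply/row_freeP; exists (\matrix_(j, i) (enum_val j == enum_val i)%:R).
  apply/matrixP => i i'; rewrite !mxE.
  under eq_bigr do rewrite !mxE mulrBl.
  rewrite sumrB (sum_deltal (fun v => (v == enum_val i')%:R)).
  rewrite (sum_deltal (fun v => (v == enum_val i')%:R)) (inj_eq enum_val_inj).
  have := enum_valP i'; rewrite !inE eq_sym => /andP[/negPf -> _].
  by rewrite subr0.
rewrite -rD; apply/eqP; rewrite eqn_leq; apply/andP; split; apply: mxrankS.
  apply/row_subP => i; have [sG tG _] := wfG _ (enum_valP i).
  pose d v : 'rV[rat]_#|V| := \row_j ((v == enum_val j)%:R - (z == enum_val j)%:R).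
  have rowd v : v \in verts G -> (d v <= D)%MS.
    move=> vG; case: (eqVneq v z) => [->|vz].
      suff -> : d z = 0 by exact: sub0mx.
      by apply/rowP => j; rewrite !mxE subrr.
    have vW : v \in W by rewrite !inE vz.
    suff -> : d v = row (enum_rank_in vW v) D by exact: row_sub.
    by apply/rowP => j; rewrite !mxE enum_rankK_in.
  have -> : row i (boundary G) = d (tgt G (enum_val i)) - d (src G (enum_val i)).
    by apply/rowP => j; rewrite !mxE; ring.
  by rewrite addmx_sub ?eqmx_opp ?rowd.
rewrite submxE; apply/eqP/matrixP => i k; rewrite !mxE.
pose c v := cokermx (boundary G) (enum_rank v) k.
have ce e : e \in edges G -> c (src G e) = c (tgt G e).
  move=> eG; apply/esym/eqP; rewrite -subr_eq0; apply/eqP.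
  have /matrixP/(_ (enum_rank_in eG e) k) := mulmx_coker (boundary G).
  rewrite [X in _ = X]mxE => <-.
  rewrite mxE -(sum_deltal c (tgt G e)) -(sum_deltal c (src G e)) -sumrB.
  by apply: eq_bigr => j _; rewrite [boundary G _ _]mxE enum_rankK_in // mulrBl /c enum_valK.
have := enum_valP i; rewrite !inE => /andP[_ iG].
have cuv := vconnected_eq cG ce iG zG.
have -> : \sum_j D i j * cokermx (boundary G) j k = c (enum_val i) - c z; last by rewrite cuv subrr.
rewrite -(sum_deltal c (enum_val i)) -(sum_deltal c z) -sumrB; apply: eq_bigr => j _.
by rewrite -mulrBl [D i j]mxE /c enum_valK.
Qed.

Lemma b1_connected G : well_formed G -> vconnected G -> verts G != finset.set0 ->
  (b1 G + #|verts G| = #|edges G| + 1)%N.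
Proof.
move=> wfG cG /set0Pn[z zG].
rewrite (cardsD1 z) zG addnCA addnA -(rank_boundary wfG cG zG) -addnA /b1.
by rewrite rank_kermxD addnC.
Qed.

(* Foster: sum_e r(e) / len e is the trace of (Laplacian) x (Green function),
   i.e. the number of vertices minus 1. *)
Lemma foster G (rho : E -> R) : well_formed G -> vconnected G -> verts G != finset.set0 ->
  (forall e, e \in edges G -> exists2 f, vpotential G (src G e) (tgt G e) f
     & rho e = f (src G e) - f (tgt G e)) ->
  \sum_(e in edges G) (1 - rho e / len G e) = (b1 G)%:R.
Proof.
move=> wfG cG nG rhoP; have [k [z kP]] := exists_green wfG cG nG.
(* [exists_green] does not record where z lies. The indicator function of [verts G] has zero energy,
   so it takes the same value at z as at a vertex u. *)
have zG : z \in verts G.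
  apply/negPn/negP => zG; case/set0Pn: nG => u uG.
  have := kP u uG (fun v => (v \in verts G)%:R); rewrite uG (negPf zG) subr0.
  rewrite /venergy big1 => [/eqP|e /wfG[-> -> _]]; first by rewrite eq_sym oner_eq0.
  by rewrite subrr mul0r.
rewrite sumrB sumr_const.
have -> : \sum_(e in edges G) rho e / len G e
    = \sum_(v in verts G) venergy G (fun w => (v == w)%:R) (k v).
  rewrite exchange_big; apply: eq_bigr => e eG /=; have [sG tG _] := wfG e eG.
  pose g v := (k v (src G e) - k v (tgt G e)) / len G e.
  have gsum u : u \in verts G -> \sum_(v in verts G) (v == u)%:R * g v = g u.
    move=> uG; rewrite (bigD1 u) //= eqxx mul1r big1 ?addr0 // => v /andP[_ /negPf ->].
    by rewrite mul0r.
  under eq_bigr => v _ do rewrite mulrBl.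
  rewrite sumrB gsum // gsum // /g -mulrBl; congr (_ / _).
  have [f pf ->] := rhoP e eG.
  (* The base point z cancels in a difference of Green functions, which is then a unit potential
     between the ends of e; the contribution of e to the trace is thus rho e / len e. *)
  have pk : vpotential G (src G e) (tgt G e) (k (src G e) \- k (tgt G e)).
    by move=> h; rewrite venergyBr !kP //; ring.
  by rewrite (vpotential_unique pf pk) /=; ring.
have -> : \sum_(v in verts G) venergy G (fun w => (v == w)%:R) (k v)
    = \sum_(v in verts G) (1 - (v == z)%:R) by apply: eq_bigr => v vG; rewrite kP // eqxx.
rewrite sumrB sumr_const (bigD1 z) //= eqxx big1 ?addr0; last by move=> v /andP[_ /negPf ->].
have := b1_connected wfG cG nG => /(congr1 (fun n => n%:R : R)); rewrite !natrD => e1.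
by move: e1 => /=; set a := _%:R; set b := _%:R; set c := _%:R => e1; lra.
Qed.

End VertexPotentials.

(** * Green functions at arbitrary points *)

Section PointPotentials.
Variables (R : realType) (V E : finType).
Implicit Types (G H : mgraph R V E) (x y p : gpoint R V E) (g : V -> R).

Lemma pt0 G e : pt G e 0 = inl (src G e) :> gpoint R V E.
Proof. by rewrite /pt lexx. Qed.

Lemma pt_len G e : 0 < len G e -> pt G e (len G e) = inl (tgt G e) :> gpoint R V E.
Proof. by move=> l0; rewrite /pt leNgt l0 /= lexx. Qed.

Lemma pt_inner G e (t : R) : 0 < t < len G e -> pt G e t = inr (e, t).
Proof. by case/andP=> t0 tl; rewrite /pt leNgt t0 /= leNgt tl. Qed.

Variant pt_spec G (e : E) (t : R) : gpoint R V E -> Prop :=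
  | PtSrc of t = 0 : pt_spec G e t (inl (src G e))
  | PtTgt of t = len G e : pt_spec G e t (inl (tgt G e))
  | PtInner of 0 < t < len G e : pt_spec G e t (inr (e, t)).

Lemma ptP G e (t : R) : 0 <= t <= len G e -> pt_spec G e t (pt G e t).
Proof.
case/andP=> t0 tl; rewrite /pt; case: ifPn => [t0'|].
  by apply: PtSrc; apply/le_anti; rewrite t0 t0'.
rewrite -ltNge => t0'; case: ifPn => [tl'|]; first by apply: PtTgt; apply/le_anti; rewrite tl tl'.
by rewrite -ltNge => tl'; apply: PtInner; rewrite t0' tl'.
Qed.

Lemma pts_pt G e (t : R) : well_formed G -> e \in edges G -> 0 <= t <= len G e -> pts G (pt G e t).
Proof.
move=> wfG eG /ptP tP; have [sG tG _] := wfG e eG.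
by case: tP => [_|_|t0l] //=; rewrite eG t0l.
Qed.

Definition interp G g p : R := match p with
  | inl v => g v
  | inr (e, t) => (1 - t / len G e) * g (src G e) + t / len G e * g (tgt G e)
  end.

Lemma interp_pt G g e (t : R) : 0 < len G e -> 0 <= t <= len G e ->
  interp G g (pt G e t) = (1 - t / len G e) * g (src G e) + t / len G e * g (tgt G e).
Proof.
move=> l0 /ptP[->|->|_] //=; first by rewrite mul0r; ring.
by rewrite divff ?gt_eqF//; ring.
Qed.

(* The default 0 is harmless: it makes the formula for [kern] below vanish. *)
Definition loc (e : E) x : R := if x is inr (e', t) then if e' == e then t else 0 else 0.

Lemma loc_in_edge G e x : well_formed G -> pts G x -> e \in edges G -> 0 <= loc e x <= len G e.
Proof.
move=> wfG; case: x => [v|[e' t]] /= Gx eG; have [_ _ l0] := wfG e eG.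
  by rewrite lexx ltW.
case: eqP Gx => [->|_ _]; last by rewrite lexx ltW.
by case/and3P=> _ t0 tl; rewrite !ltW.
Qed.

Lemma loc_breaks G X e x : x \in X -> loc e x \in breaks G X e.
Proof.
rewrite mem_breaks; case: x => [v|[e' t]] /= xX; first by rewrite eqxx.
by case: (e' =P e) xX => [->|_] xX; rewrite ?xX ?eqxx ?orbT.
Qed.

(* The Green function of the segment e with grounded ends: its second
   derivative in either variable is minus the Dirac mass at the other one. *)
Definition kern G p x : R :=
  if p is inr (e, t) then Num.min t (loc e x) - t * loc e x / len G e else 0.

(** The formula vanishes at both ends of the edge, so it also covers the vertices, where [kern] is 0
    by definition. *)
Lemma kern_pt G e x (t : R) : well_formed G -> pts G x -> e \in edges G -> 0 <= t <= len G e ->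
  kern G (pt G e t) x = Num.min t (loc e x) - t * loc e x / len G e.
Proof.
move=> wfG Gx eG t0l; have /andP[l0 ll] := loc_in_edge wfG Gx eG.
have [_ _ len0] := wfG e eG.
case: (ptP t0l) => [->|->|_] //=; first by rewrite min_l // mul0r; ring.
by rewrite min_r // mulrAC divff ?gt_eqF// mul1r subrr.
Qed.

Lemma kern_sym G p x : pts G p -> pts G x -> kern G p x = kern G x p.
Proof.
case: p x => [v|[e t]] [v'|[e' t']] //=.
- by move=> _ /and3P[_ /ltW t0 _]; rewrite min_r // mulr0 mul0r subrr.
- by move=> /and3P[_ /ltW t0 _] _; rewrite min_r // mulr0 mul0r subrr.
case: (eqVneq e' e) => [->|ne] /and3P[_ /ltW t0 _] /and3P[_ /ltW t0' _].
  by rewrite minC [t * _]mulrC.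
by rewrite !min_r // !mulr0 !mul0r.
Qed.

(** On the edge t = min t (len e), so up to a constant F is a combination of three minima taken at
    breaks, and [pieces_min] applies to each of them. *)
Lemma pieces_piecewise G X e (h F : R -> R) (c0 c1 s s' : R) :
  on_graph G X -> 0 <= len G e -> s \in breaks G X e -> s' \in breaks G X e ->
  (forall t, 0 <= t <= len G e -> F t = c0 + c1 * t + Num.min t s - Num.min t s') ->
  \sum_(st <- pieces G X e) (h st.1 - h st.2) * ((F st.1 - F st.2) / (st.2 - st.1))
  = c1 * (h (len G e) - h 0) + (h s - h s').
Proof.
move=> GX l0 sb sb' FE.
have lb : len G e \in breaks G X e by rewrite mem_breaks eqxx orbT.
have := pieces_min h GX l0 sb'; have := pieces_min h GX l0 sb; have := pieces_min h GX l0 lb.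
set A := \sum_(_ <- _) _; set B := \sum_(_ <- _) _; set C := \sum_(_ <- _) _ => EA EB EC.
transitivity (c1 * A + B - C); last by rewrite EA EB EC; ring.
rewrite /A /B /C mulr_sumr -big_split -sumrB /= big_seq [RHS]big_seq.
apply: eq_bigr => st /mem_pieces[s1 s2].
have /andP[s10 s1l] := breaks_in_edge GX l0 s1.
have /andP[s20 s2l] := breaks_in_edge GX l0 s2.
by rewrite !FE ?s10 ?s20 // !(min_l s1l) !(min_l s2l); ring.
Qed.

(** The interpolated part tests h at the vertices only; the kernel at z represents the defect
    between h z and the interpolation at z of the vertex values of h. *)
Lemma dform_interp G x y (h : gpoint R V E -> R) g : well_formed G -> pts G x -> pts G y ->
  dform G [:: x; y] h (fun p => interp G g p + kern G p x - kern G p y)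
  = venergy G (h \o inl) g + (h x - interp G (h \o inl) x) - (h y - interp G (h \o inl) y).
Proof.
move=> wfG Gx Gy.
have GX : on_graph G [:: x; y] by move=> p; rewrite !inE => /orP[]/eqP->.
(* The defect is spread over all edges to match the form; only an edge with z in its interior
   contributes, since [loc] is 0 on the others. *)
have bump z : pts G z -> h z - interp G (h \o inl) z
    = \sum_(e in edges G) (h (pt G e (loc e z)) - h (inl (src G e))
        - loc e z / len G e * (h (inl (tgt G e)) - h (inl (src G e)))).
  case: z => [v|[e0 t]] /= => [_|/andP[eG t0l]].
    by rewrite subrr big1 // => e _; rewrite pt0 mul0r; ring.
  rewrite (bigD1 e0) //= eqxx big1 => [|e /andP[_ /negPf ne]]; last first.
    by rewrite eq_sym ne pt0 mul0r; ring.
  by rewrite pt_inner //; ring.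
rewrite (bump _ Gx) (bump _ Gy) /venergy -big_split -sumrB; apply: eq_bigr => e eG /=.
have [_ _ l0] := wfG e eG.
rewrite (@pieces_piecewise G [:: x; y] e (fun t => h (pt G e t))
  (fun t => interp G g (pt G e t) + kern G (pt G e t) x - kern G (pt G e t) y)
  (g (src G e)) ((g (tgt G e) - g (src G e)) / len G e - loc e x / len G e + loc e y / len G e)
  (loc e x) (loc e y)) ?ltW ?loc_breaks ?inE ?eqxx ?orbT //; last first.
  by move=> t t0l; rewrite interp_pt // !kern_pt //; ring.
by rewrite pt0 pt_len //; ring.
Qed.

Definition pgreen G (k : V -> V -> R) x p : R :=
  interp G (fun v => interp G (k^~ v) x) p + kern G p x.

Lemma interp_exchange G (k : V -> V -> R) x p :
  interp G (fun v => interp G (k^~ v) x) p = interp G (fun u => interp G (k u) p) x.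
Proof. by case: x p => [u|[e t]] [v|[e' t']] //=; ring. Qed.

(** The potentials k u are fixed only up to constants, so k need not be symmetric, and exchanging
    the two points transposes it. Bounds in one variable thereby yield bounds in the other. *)
Lemma pgreenC G k x p : pts G x -> pts G p ->
  pgreen G k x p = pgreen G (fun u v => k v u) p x.
Proof. by move=> Gx Gp; rewrite /pgreen kern_sym // interp_exchange. Qed.

Definition green_kernel G (k : V -> V -> R) :=
  exists z, forall u, u \in verts G -> vpotential G u z (k u).

(** The interpolated vertex potentials produce the interpolated values of h at x and y, the kernels
    add the missing defects, and the base point z cancels. *)
Lemma pgreen_potential G k x y : well_formed G -> green_kernel G k -> pts G x -> pts G y ->
  weak_unit_potential G x y (fun p => pgreen G k x p - pgreen G k y p).
Proof.
move=> wfG [z kP] Gx Gy h.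
have vk w : pts G w -> venergy G (h \o inl) (fun v => interp G (k^~ v) w)
    = interp G (h \o inl) w - h (inl z).
  case: w => [v|[e t]] /= Gw; first exact: kP.
  case/andP: Gw => eG _; have [sG tG _] := wfG e eG.
  rewrite (venergyDr _ _ ((1 - t / len G e) \*o k (src G e)) ((t / len G e) \*o k (tgt G e))).
  by rewrite !venergyZr !kP //=; ring.
pose g := (fun v => interp G (k^~ v) x) \- (fun v => interp G (k^~ v) y).
transitivity (dform G [:: x; y] h (fun p => interp G g p + kern G p x - kern G p y)).
  congr dform; apply/funext => p; rewrite /pgreen /g.
  by case: p => [v|[e t]] /=; ring.
by rewrite dform_interp // venergyBr !vk //; ring.
Qed.

Lemma resistance_pgreen G k x y : well_formed G -> green_kernel G k -> pts G x -> pts G y ->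
  resistance G x y = pgreen G k x x - pgreen G k y x - (pgreen G k x y - pgreen G k y y).
Proof. by move=> wfG kP Gx Gy; rewrite (resistanceE (pgreen_potential wfG kP Gx Gy)). Qed.

Lemma interp_bound G g (M : R) p : well_formed G -> pts G p ->
  (forall v, `|g v| <= M) -> `|interp G g p| <= M.
Proof.
move=> wfG; case: p => [v|[e t]] //= /andP[eG /andP[/ltW t0 /ltW tl]] gM.
have [_ _ l0] := wfG e eG.
have u0 : 0 <= t / len G e by rewrite divr_ge0 // ltW.
have u1 : 0 <= 1 - t / len G e by rewrite subr_ge0 ler_pdivrMr // mul1r.
rewrite (le_trans (ler_normD _ _)) // normrM (ger0_norm u1) normrM (ger0_norm u0).
have -> : M = (1 - t / len G e) * M + t / len G e * M by ring.
by rewrite lerD // ler_wpM2l.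
Qed.

Lemma min_lipschitz (s t l : R) : `|Num.min s l - Num.min t l| <= `|s - t|.
Proof.
have min_lip1 (a b c : R) : a <= b -> `|Num.min a c - Num.min b c| <= b - a.
  move=> ab; rewrite ler0_norm; first by case: (leP a c); case: (leP b c); lra.
  by rewrite subr_le0; case: (leP a c); case: (leP b c); lra.
case: (leP s t) => [st|/ltW ts]; first by rewrite [`|s - t|]ler0_norm ?subr_le0// opprB min_lip1.
by rewrite distrC [`|s - t|]ger0_norm ?subr_ge0// min_lip1.
Qed.

Lemma pgreen_lipschitzr G k e : well_formed G -> e \in edges G ->
  exists C, forall x s t, pts G x -> 0 <= s <= len G e -> 0 <= t <= len G e ->
    `|pgreen G k x (pt G e s) - pgreen G k x (pt G e t)| <= C * `|s - t|.
Proof.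
move=> wfG eG; have [_ _ l0] := wfG e eG.
pose M := \sum_u \sum_v `|k u v|.
have kM u v : `|k u v| <= M.
  rewrite /M (bigD1 u) //= (bigD1 v) //= -addrA lerDl addr_ge0 ?sumr_ge0 // => w _.
  by rewrite sumr_ge0.
(* The interpolation has slope at most 2M / len; the minimum is 1-Lipschitz, and the linear part of
   the kernel has slope l / len, at most 1. None of these depends on x. *)
exists (2 * M / len G e + 2) => x s t Gx s0l t0l.
rewrite /pgreen !interp_pt // !kern_pt //.
set g := interp G _ x; set g' := interp G _ x; set l := loc e x.
have gM : `|g| <= M by exact: interp_bound.
have gM' : `|g'| <= M by exact: interp_bound.
have /andP[ll lle] := loc_in_edge wfG Gx eG.
have -> : (1 - s / len G e) * g + s / len G e * g' + (Num.min s l - s * l / len G e)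
   - ((1 - t / len G e) * g + t / len G e * g' + (Num.min t l - t * l / len G e))
   = (g' - g) / len G e * (s - t) + (Num.min s l - Num.min t l) - l / len G e * (s - t) by ring.
have -> : (2 * M / len G e + 2) * `|s - t|
  = 2 * M / len G e * `|s - t| + `|s - t| + 1 * `|s - t| by ring.
apply: le_trans (ler_normB _ _) _; apply: lerD; last first.
  by rewrite normrM ler_wpM2r // ger0_norm ?divr_ge0 ?(ltW l0) // ler_pdivrMr // mul1r.
apply: le_trans (ler_normD _ _) _; apply: lerD; last exact: min_lipschitz.
rewrite !normrM ler_wpM2r // [`|(len G e)^-1|]gtr0_norm ?invr_gt0 // ler_wpM2r ?invr_ge0 ?(ltW l0) //.
by apply: le_trans (ler_normB _ _) _; rewrite mulrDl mul1r lerD.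
Qed.

Lemma pgreen_lipschitz G k e : well_formed G -> e \in edges G ->
  exists C, forall x s t, pts G x -> 0 <= s <= len G e -> 0 <= t <= len G e ->
    `|pgreen G k x (pt G e s) - pgreen G k x (pt G e t)| <= C * `|s - t| /\
    `|pgreen G k (pt G e s) x - pgreen G k (pt G e t) x| <= C * `|s - t|.
Proof.
move=> wfG eG; have [C1 P1] := pgreen_lipschitzr k wfG eG.
have [C2 P2] := pgreen_lipschitzr (fun u v => k v u) wfG eG.
exists (Num.max C1 C2) => x s t Gx s0l t0l; split.
  by apply: le_trans (P1 x s t Gx s0l t0l) _; rewrite ler_wpM2r // le_max lexx.
rewrite (pgreenC k (pts_pt wfG eG s0l) Gx) (pgreenC k (pts_pt wfG eG t0l) Gx).
by apply: le_trans (P2 x s t Gx s0l t0l) _; rewrite ler_wpM2r // le_max lexx orbT.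
Qed.

Lemma resistance_lipschitz G e : well_formed G -> vconnected G -> e \in edges G ->
  exists C, forall x s t, pts G x -> 0 <= s <= len G e -> 0 <= t <= len G e ->
    `|resistance G x (pt G e s) - resistance G x (pt G e t)| <= C * `|s - t| /\
    `|resistance G (pt G e s) x - resistance G (pt G e t) x| <= C * `|s - t|.
Proof.
move=> wfG cG eG; have [sG _ _] := wfG e eG.
have nG : verts G != finset.set0 by apply/set0Pn; exists (src G e).
have [k [z kz]] := exists_green wfG cG nG; have kP : green_kernel G k by exists z.
have [C CP] := pgreen_lipschitz k wfG eG.
(* Of the four Green terms of the resistance, p(s, s) is moved to p(t, t) in two steps through (s,
   t), the two mixed terms take one step each, and p(x, x) is fixed: hence the factor 4. *)
have main x s t : pts G x -> 0 <= s <= len G e -> 0 <= t <= len G e ->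
    `|resistance G (pt G e s) x - resistance G (pt G e t) x| <= 4 * C * `|s - t|.
  move=> Gx s0l t0l.
  have Gs := pts_pt wfG eG s0l; have Gt := pts_pt wfG eG t0l.
  rewrite !(resistance_pgreen wfG kP) //.
  have [A1 A2] := CP x s t Gx s0l t0l.
  have [B1 _] := CP _ s t Gs s0l t0l; have [_ B2] := CP _ s t Gt s0l t0l.
  move: A1 A2 B1 B2; rewrite !ler_norml.
  by move=> /andP[? ?] /andP[? ?] /andP[? ?] /andP[? ?]; apply/andP; split; lra.
exists (4 * C) => x s t Gx s0l t0l; split; last exact: main.
have sym a b : pts G a -> pts G b -> resistance G a b = resistance G b a.
  by move=> Ga Gb; rewrite !(resistance_pgreen wfG kP) //; ring.
rewrite (sym x _ Gx (pts_pt wfG eG s0l)) (sym x _ Gx (pts_pt wfG eG t0l)); exact: main.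
Qed.

Lemma dform_vertices G u v (h f : gpoint R V E -> R) : well_formed G ->
  dform G [:: inl u; inl v] h f = venergy G (h \o inl) (f \o inl).
Proof.
move=> wfG; apply: eq_bigr => e eG; have [_ _ l0] := wfG e eG.
have -> : pieces G [:: inl u; inl v] e = [:: (0, len G e)].
  rewrite /pieces /breaks /= inE lt_eqF //= sort_le_id //=.
  by rewrite ltW.
by rewrite big_seq1 /= pt0 pt_len // subr0.
Qed.

Lemma vpotential_weak G u v (f : gpoint R V E -> R) : well_formed G ->
  vpotential G u v (f \o inl) <-> weak_unit_potential G (inl u) (inl v) f.
Proof.
move=> wfG; split=> pf h; first by rewrite dform_vertices // pf.
pose h' p : R := if p is inl w then h w else 0.
by have := pf h'; rewrite dform_vertices.
Qed.

Lemma well_formed_del G e : well_formed G -> well_formed (del_edge G e).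
Proof. by move=> wfG e'; rewrite !inE => /andP[_ /wfG]. Qed.

Lemma venergy_del G e h f : e \in edges G -> venergy G h f =
  (h (src G e) - h (tgt G e)) * ((f (src G e) - f (tgt G e)) / len G e)
  + venergy (del_edge G e) h f.
Proof. by move=> eG; rewrite /venergy (big_setD1 e). Qed.

Definition edge_density G e : R :=
  match edge_resistance G e with EFin r => (len G e + r)^-1 | _ => 0 end.

(* Parallel law: 1/r = 1/len + 1/r_e, with r = len if e is a bridge. *)
Lemma edge_densityE G e (f : V -> R) : well_formed G -> e \in edges G ->
  vpotential G (src G e) (tgt G e) f ->
  edge_density G e * len G e = 1 - (f (src G e) - f (tgt G e)) / len G e.
Proof.
move=> wfG eG pf; have [_ _ l0] := wfG e eG; have wfD := @well_formed_del G e wfG.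
set r := f _ - _; set D := del_edge G e.
have [[f' pf']|noex] := pselect (exists f', vpotential D (src G e) (tgt G e) f').
  pose F p : R := if p is inl w then f' w else 0.
  have wF : weak_unit_potential D (inl (src G e)) (inl (tgt G e)) F by apply/vpotential_weak.
  rewrite /edge_density /edge_resistance (eresistanceE wF) /=.
  set r' := f' _ - _.
  have r'0 : 0 <= r'.
    rewrite /r' -(pf' f'); apply: sumr_ge0 => e' /wfD[_ _ l'].
    by rewrite mulrA divr_ge0 ?(ltW l') // -expr2 sqr_ge0.
  have lr : len G e + r' != 0 by rewrite gt_eqF // ltr_pwDl.
  (* The scalar is the fraction of a unit current that avoids e when e and the rest of G, of
     resistance r', are in parallel. *)
  have pf1 : vpotential G (src G e) (tgt G e) ((len G e / (len G e + r')) \*o f').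
    move=> h; rewrite venergyZr (venergy_del _ _ eG) pf' -/r'.
    by field; rewrite lr gt_eqF.
  rewrite /r (vpotential_unique pf pf1) /=.
  have -> : len G e / (len G e + r') * f' (src G e) - len G e / (len G e + r') * f' (tgt G e)
    = len G e / (len G e + r') * r' by rewrite /r'; ring.
  by field; rewrite lr gt_eqF.
(* The current of f outside e is 1 - r / len. If it were nonzero, rescaling f would give a unit
   potential on G without e, contrary to [noex]. *)
have rl : r = len G e.
  apply/eqP/negPn/negP => nrl; apply: noex.
  have n1 : len G e - r != 0 by rewrite subr_eq0 eq_sym.
  exists ((len G e / (len G e - r)) \*o f) => h.
  have := pf h; rewrite (venergy_del _ _ eG) -/r venergyZr => Eh.
  have -> : venergy D h f = h (src G e) - h (tgt G e)
      - (h (src G e) - h (tgt G e)) * (r / len G e) by rewrite -{1}Eh; ring.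
  by field; rewrite n1 gt_eqF.
rewrite rl divff ?gt_eqF // subrr /edge_density /edge_resistance /eresistance.
case: xgetP => [r' -> [F uF _]|_]; last by rewrite mul0r.
case: noex; exists (F \o inl).
by apply/vpotential_weak => //; exact: unit_potential_weak.
Qed.

Lemma connected_vconnected G : connected_mgraph G -> vconnected G.
Proof.
case=> wfG _ cG c ce u v uG vG.
pose c' (p : gpoint R V E) := match p with inl w => c w | inr (e, _) => c (src G e) end.
have seg p p' : segment_in G (pts G) p p' -> c' p = c' p'.
  have cpt e t : e \in edges G -> 0 <= t <= len G e -> c' (pt G e t) = c (src G e).
    by move=> eG /ptP[] //=; rewrite ce.
  case=> e [s [t [eG [s0 st tl] -> -> _]]].
  by rewrite !cpt // ?s0 ?(le_trans s0 st) // (le_trans st tl).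
have jn p p' : joined G (pts G) p p' -> c' p = c' p'.
  by elim=> [a b /seg //|//|a b _ -> //|a b d _ -> _ ->].
exact: jn (cG (inl u) (inl v) uG vG).
Qed.

Lemma connected_verts G : connected_mgraph G -> verts G != finset.set0.
Proof.
case=> wfG [[v|[e t]] /= Gp] _; apply/set0Pn; first by exists v.
by case/andP: Gp => /wfG[sG _ _] _; exists (src G e).
Qed.

End PointPotentials.

(** * Retractions and branches *)

Section Subgraphs.
Variables (R : realType) (V E : finType).
Implicit Types (G H B : mgraph R V E) (A p x : gpoint R V E).

Lemma venergy_retract G B (rho : V -> V) h f : subgraph B G ->
  (forall e, e \in edges B -> rho (src G e) = src G e /\ rho (tgt G e) = tgt G e) ->
  (forall e, e \in edges G -> e \notin edges B -> rho (src G e) = rho (tgt G e)) ->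
  venergy G h (f \o rho) = venergy B h f.
Proof.
case=> _ BG BE rhoB rhoG; rewrite /venergy (big_setID (edges B)) /= (finset.setIidPr BG).
rewrite [X in _ + X]big1 ?addr0 => [|e].
  by apply: eq_bigr => e eB; have [-> ->] := rhoB e eB; have [-> -> ->] := BE e eB.
by rewrite !inE => /andP[eB eG]; rewrite (rhoG e eG eB) subrr mul0r mulr0.
Qed.

(* Dangling parts carry no current, so they do not change effective
   resistances inside a retract. *)
Lemma edge_density_retract G B (rho : V -> V) (f : V -> R) e : well_formed G -> subgraph B G ->
  (forall e, e \in edges B -> rho (src G e) = src G e /\ rho (tgt G e) = tgt G e) ->
  (forall e, e \in edges G -> e \notin edges B -> rho (src G e) = rho (tgt G e)) ->
  e \in edges B -> vpotential B (src B e) (tgt B e) f ->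
  edge_density G e * len G e = 1 - (f (src B e) - f (tgt B e)) / len B e.
Proof.
move=> wfG sB rhoB rhoG eB pf.
have [-> -> ->] : [/\ src B e = src G e, tgt B e = tgt G e & len B e = len G e] by case: sB => _ _; exact.
have [rs rt] := rhoB e eB; have [_ /fintype.subsetP/(_ e eB) eG BE] := sB.
have [Es Et _] := BE e eB; rewrite Es Et in pf.
rewrite (@edge_densityE _ _ _ _ _ (f \o rho)) ?rs ?rt //= ?rs ?rt // => h.
by rewrite (venergy_retract _ _ sB).
Qed.

Lemma foster_density G B (rho : V -> V) : well_formed G -> subgraph B G ->
  well_formed B -> vconnected B -> verts B != finset.set0 ->
  (forall e, e \in edges B -> rho (src G e) = src G e /\ rho (tgt G e) = tgt G e) ->
  (forall e, e \in edges G -> e \notin edges B -> rho (src G e) = rho (tgt G e)) ->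
  \sum_(e in edges B) edge_density G e * len G e = (b1 B)%:R.
Proof.
move=> wfG sB wfB cB nB rhoB rhoG.
have [r rP] : exists r : E -> R, forall e, e \in edges B ->
    exists2 f, vpotential B (src B e) (tgt B e) f & r e = f (src B e) - f (tgt B e).
  have : forall e, exists r : R, e \in edges B ->
    exists2 f, vpotential B (src B e) (tgt B e) f & r = f (src B e) - f (tgt B e).
    move=> e; case: (boolP (e \in edges B)) => [eB|_]; last by exists 0.
    have [sG tG _] := wfB e eB; have [f pf] := exists_vpotential wfB cB sG tG.
    by exists (f (src B e) - f (tgt B e)) => _; exists f.
  by case/choice => r rP; exists r.
rewrite -(foster wfB cB nB rP); apply: eq_bigr => e eB.
by have [f pf ->] := rP e eB; exact: (edge_density_retract wfG sB rhoB rhoG eB pf).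
Qed.

Lemma b1_no_edges G : edges G = finset.set0 -> b1 G = 0%N.
Proof.
move=> eG; apply/eqP; rewrite -leqn0 /b1.
by rewrite (leq_trans (rank_leq_row _)) // eG cards0.
Qed.

Definition retraction G H (pi : V -> V) : Prop :=
  [/\ subgraph H G, {in verts H, forall v, pi v = v}, {in verts G, forall v, pi v \in verts H}
    & forall e, e \in edges G -> e \notin edges H -> pi (src G e) = pi (tgt G e)].

Definition retract G H (pi : V -> V) p : gpoint R V E := match p with
  | inl v => inl (pi v)
  | inr (e, t) => if e \in edges H then inr (e, t) else inl (pi (src G e))
  end.

End Subgraphs.

Section Retraction.
Variables (R : realType) (V E : finType) (G H : mgraph R V E) (pi : V -> V).
Hypotheses (cG : connected_mgraph G) (cH : connected_mgraph H) (retr : retraction G H pi).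
Implicit Types (A p x : gpoint R V E).

Let wfG : well_formed G. Proof. by case: cG. Qed.
Let wfH : well_formed H. Proof. by case: cH. Qed.
Let sub : subgraph H G. Proof. by case: retr. Qed.
Let piH : {in verts H, forall v, pi v = v}. Proof. by case: retr. Qed.
Let piG : {in verts G, forall v, pi v \in verts H}. Proof. by case: retr. Qed.
Let piE e : e \in edges G -> e \notin edges H -> pi (src G e) = pi (tgt G e).
Proof. by case: retr => _ _ _; exact. Qed.

Local Notation ret := (retract G H pi).

Lemma sub_edge e : e \in edges H ->
  [/\ e \in edges G, src H e = src G e, tgt H e = tgt G e & len H e = len G e].
Proof. by case: sub => _ /fintype.subsetP eHG sH eH; have [] := sH e eH; split=> //; exact: eHG. Qed.

Lemma sub_pt e t : e \in edges H -> pt H e t = pt G e t.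
Proof. by move=> /sub_edge[_ ss st sl]; rewrite /pt ss st sl. Qed.

Lemma sub_pts p : pts H p -> pts G p.
Proof.
case: p => [v|[e t]] /=; first by case: sub => /fintype.subsetP vHG _ _; exact: vHG.
by case/andP=> /sub_edge[-> _ _ ->].
Qed.

Lemma retract_id p : pts H p -> ret p = p.
Proof. by case: p => [v /piH /= -> //|[e t] /= /andP[-> _]]. Qed.

Lemma retract_pts p : pts G p -> pts H (ret p).
Proof.
case: p => [v /piG //|[e t] /= /andP[eG tl]].
case: ifP => eH /=; last by have [/piG] := wfG eG.
by have [_ _ _ ->] := sub_edge eH; rewrite eH.
Qed.

Lemma edge_end_retract e : e \in edges H -> pi (src G e) = src G e /\ pi (tgt G e) = tgt G e.
Proof.
by move=> eH; have [_ <- <- _] := sub_edge eH; have [sH tH _] := wfH eH; rewrite !piH.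
Qed.

Lemma retract_pt_in e t : e \in edges H -> 0 <= t <= len G e -> ret (pt G e t) = pt G e t.
Proof.
by move=> eH; have [ps pt'] := edge_end_retract eH; case/ptP => _ /=; rewrite ?eH ?ps ?pt'.
Qed.

Lemma retract_pt_out e t : e \in edges G -> e \notin edges H -> 0 <= t <= len G e ->
  ret (pt G e t) = inl (pi (src G e)).
Proof. by move=> eG eH /ptP[_|_|_] //=; rewrite ?(negPf eH) // (piE eG eH). Qed.

(** An allowed segment meets H at most in A. On an edge of H all its points are therefore equal to
    A, and along any other edge the retraction is constant. *)
Lemma joined_retract A p : joined G (pts G `\` (pts H `\` [set A])) A p -> pts H A ->
  pts G p /\ ret p = A.
Proof.
move=> jn HA; set S := (S in joined G S) in jn.
have seg a b : segment_in G S a b -> (pts G a -> ret a = A -> pts G b /\ ret b = A)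
    /\ (pts G b -> ret b = A -> pts G a /\ ret a = A).
  case=> e [s [t [eG [s0 st tl] -> -> inS]]].
  have s0l : 0 <= s <= len G e by rewrite s0 (le_trans st tl).
  have t0l : 0 <= t <= len G e by rewrite tl (le_trans s0 st).
  have Gs := pts_pt wfG eG s0l; have Gt := pts_pt wfG eG t0l.
  case: (boolP (e \in edges H)) => eH; last by rewrite !retract_pt_out.
  rewrite !retract_pt_in //.
  have inA u : s <= u <= t -> pt G e u = A.
    move=> /andP[su ut]; have [_ /not_andP[Hu|]] := inS u (introT andP (conj su ut)).
      by case: Hu; rewrite -sub_pt //; apply: pts_pt => //;
         have [_ _ _ ->] := sub_edge eH; rewrite (le_trans s0 su) (le_trans ut tl).
    exact: contrapT.
  by rewrite !inA ?lexx ?st.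
have P a b : joined G S a b -> (pts G a -> ret a = A -> pts G b /\ ret b = A)
    /\ (pts G b -> ret b = A -> pts G a /\ ret a = A).
  elim=> [c d /seg //|//|c d _ [] //|c d f _ [IH1 IH2] _ [IH3 IH4]]; split=> Gp rp.
    by case: (IH1 Gp rp); exact: IH3.
  by case: (IH4 Gp rp); exact: IH2.
by case: (P A p jn) => [/(_ (sub_pts HA) (retract_id HA))].
Qed.

Lemma finite_closed (S : set R) : finite_set S -> closed S.
Proof.
move=> fS; apply: accessible_finite_set_closed.1 => //.
by apply: hausdorff_accessible; exact: norm_hausdorff.
Qed.

(** Taking the closure adds nothing, since the fibre is closed on each edge: an edge outside H lies
    in it entirely or misses it, and on an edge of H only the finitely many parameters of A
    occur. *)
Lemma branchE A : pts H A -> branch G H A = [set p | pts G p /\ ret p = A].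
Proof.
move=> HA; rewrite /branch; set S := pts G `\` _.
have fibS p : pts G p -> ret p = A -> S p.
  by move=> Gp rp; split=> // -[/retract_id]; rewrite rp => -> /(_ erefl).
apply/seteqP; split=> p.
  case=> [/= jn|[e [t [eG t0l -> cl]]]]; first exact: joined_retract jn HA.
  split; first exact: pts_pt.
  have {}cl : closure [set u | 0 <= u <= len G e /\ ret (pt G e u) = A] t.
    by apply: closureS cl => u [u0l /joined_retract[]//].
  case: (boolP (e \in edges H)) => eH; last first.
    have [u [[u0l ru] _]] := cl setT filterT.
    by rewrite retract_pt_out // -ru retract_pt_out.
  pose Z := [set u | 0 <= u <= len G e /\ pt G e u = A].
  have ZF : finite_set Z.
    apply: (@sub_finite_set _ _ [set 0; len G e; loc e A]).
      move=> u [u0l]; case: (ptP u0l) => [->|->|_] Au /=; [by left; left|by left; right|].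
      by right; rewrite -Au /= eqxx.
    by rewrite !finite_setU.
  have clZ : closure Z t by apply: closureS cl => u [u0l]; rewrite retract_pt_in.
  move: clZ; rewrite -(closure_id Z).1 => [[_ pA]|]; last exact: finite_closed.
  by rewrite retract_pt_in.
case=> Gp rp; left => /=.
have reach v : v \in verts G -> inl (pi v) = A -> joined G S A (inl v).
  (* The fibre is connected: the property c holds at both ends of an edge of H, and on any other
     edge the ends lie in the same fibre and are joined inside it. Connectedness of G then carries c
     from pi v, where it is clear, to v. *)
  move=> vG piA; pose c w := `[< inl (pi w) = A -> joined G S A (inl w) >].
  have ce e : e \in edges G -> c (src G e) = c (tgt G e).
    move=> eG; have [_ _ l0] := wfG eG; apply/asbool_equiv_eq.
    case: (boolP (e \in edges H)) => eH.
      have [-> ->] := edge_end_retract eH.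
      by split=> _ ->; exact: rst_refl.
    rewrite (piE eG eH).
    have seg : inl (pi (src G e)) = A -> joined G S (inl (src G e)) (inl (tgt G e)).
      move=> pA; rewrite -(pt0 G e) -(pt_len l0).
      apply: rst_step; exists e, 0, (len G e); split=> //; first by split=> //; exact: ltW.
      move=> u u0l; apply: fibS; first exact: pts_pt.
      by rewrite retract_pt_out.
    rewrite -(piE eG eH); split=> jn pA.
      exact: rst_trans (jn pA) (seg pA).
    exact: rst_trans (jn pA) (rst_sym _ _ _ _ (seg pA)).
  have pvG : pi v \in verts G by have := sub_pts (retract_pts (p := inl v) vG).
  have := connected_vconnected cG ce vG pvG; rewrite /c (piH (piG vG)).
  have -> : `[< inl (pi v) = A -> joined G S A (inl (pi v)) >].
    by apply/asboolP => ->; exact: rst_refl.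
  by move/asboolP; exact.
case: p Gp rp => [v|[e t]] /=; first by move=> *; exact: reach.
case/andP=> eG t0l; case: ifPn => [eH <-|eH pA]; first exact: rst_refl.
have [sG _ _] := wfG eG; have /andP[t0 tl] := t0l.
apply: rst_trans (reach _ sG pA) _; apply: rst_step; exists e, 0, t; split=> //.
- by split=> //; exact: ltW.
- by rewrite pt0.
- by rewrite pt_inner.
move=> u /andP[u0 ut]; have u0l : 0 <= u <= len G e by rewrite u0 (le_trans ut (ltW tl)).
by apply: fibS; [exact: pts_pt|rewrite retract_pt_out].
Qed.

Lemma branch_verts a v : a \in verts H ->
  (v \in verts (subgraph_of G (branch G H (inl a)))) = (v \in verts G) && (pi v == a).
Proof.
move=> aH; rewrite !inE branchE //=; case: (boolP (v \in verts G)) => //= vG.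
by apply/asboolP/eqP => [[_ [->]]//|->].
Qed.

Lemma branch_edges A e : pts H A ->
  (e \in edges (subgraph_of G (branch G H A)))
  = [&& e \in edges G, e \notin edges H & inl (pi (src G e)) == A].
Proof.
move=> HA; rewrite !inE branchE //=; case: (boolP (e \in edges G)) => //= eG.
have [_ _ l0] := wfG eG; apply/asboolP/andP => [all|[eH /eqP pA] t t0l]; last first.
  by rewrite (negPf eH).
(* Two interior points suffice: on an edge of H the retraction fixes both, so they cannot both be
   A. *)
have h1 : 0 < len G e / 2 < len G e by lra.
have h2 : 0 < len G e / 3 < len G e by lra.
have [_ A1] := all _ h1; have [_ A2] := all _ h2; move: A1 A2.
case: ifP => [_ <- [E2]|_ -> _]; last by rewrite eqxx.
exfalso; move: E2 => /eqP; apply/negP/eqP; lra.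
Qed.

Lemma branch_subgraph A : subgraph (subgraph_of G (branch G H A)) G.
Proof. by split=> //; apply/fintype.subsetP => z; rewrite inE => /andP[]. Qed.

Lemma branch_wf a : a \in verts H -> well_formed (subgraph_of G (branch G H (inl a))).
Proof.
move=> aH e; rewrite branch_edges // => /and3P[eG eH /eqP[pa]]; have [sG tG l0] := wfG eG.
by split=> //; rewrite branch_verts //= ?sG ?tG -?(piE eG eH) pa eqxx.
Qed.

Lemma branch_nonempty a : a \in verts H ->
  verts (subgraph_of G (branch G H (inl a))) != finset.set0.
Proof.
move=> aH; apply/set0Pn; exists a; rewrite branch_verts // piH // eqxx andbT.
exact: (sub_pts (p := inl a)).
Qed.

(** Extending c from the branch by its value at the root a creates no jump along the edges of G. For
    a two-valued c this gives the connectedness of the branch, for c = id a retraction of G onto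
    it. *)
Lemma branch_const (T : Type) (c : V -> T) a e : a \in verts H -> e \in edges G ->
  (e \in edges (subgraph_of G (branch G H (inl a))) -> c (src G e) = c (tgt G e)) ->
  (if pi (src G e) == a then c (src G e) else c a) = (if pi (tgt G e) == a then c (tgt G e) else c a).
Proof.
move=> aH eG; rewrite branch_edges // eG /=.
case: (boolP (e \in edges H)) => eH /=.
  by have [-> ->] := edge_end_retract eH => _; do 2! [case: eqP => [->|_]].
rewrite -(piE eG eH); case: (pi (src G e) =P a) => [-> -> //|//].
Qed.

Lemma branch_vconnected a : a \in verts H -> vconnected (subgraph_of G (branch G H (inl a))).
Proof.
move=> aH c ce u v; rewrite !branch_verts // => /andP[uG /eqP pu] /andP[vG /eqP pv].
have := connected_vconnected cG (c := fun w => if pi w == a then c w else c a) _ uG vG.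
by rewrite pu pv eqxx; apply => e eG; apply: branch_const => //; exact: ce.
Qed.

Lemma b1_branch A : pts H A -> (b1 (subgraph_of G (branch G H A)))%:R =
  \sum_(e | [&& e \in edges G, e \notin edges H & inl (pi (src G e)) == A])
     edge_density G e * len G e.
Proof.
move=> HA.
transitivity (\sum_(e in edges (subgraph_of G (branch G H A))) edge_density G e * len G e);
  last by apply: eq_bigl => e; rewrite branch_edges.
case: A HA => [a|[e t]] HA; last first.
  have eB : edges (subgraph_of G (branch G H (inr (e, t)))) = finset.set0.
    by apply/setP => e'; rewrite branch_edges // !andbF inE.
  by rewrite b1_no_edges // eB big_set0.
rewrite (@foster_density _ _ _ G _ (fun w => if pi w == a then w else a)) //.
- exact: branch_subgraph.
- exact: branch_wf.
- exact: branch_vconnected.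
- exact: branch_nonempty.
- move=> e; rewrite branch_edges // => /and3P[eG eH /eqP[pa]].
  by rewrite -(piE eG eH) pa eqxx.
move=> e eG /negPf eB; apply: (branch_const (c := id)) => //.
by rewrite eB.
Qed.

(** One unit potential of H computes both densities, because what hangs off H carries no current. *)
Lemma edge_density_sub e : e \in edges H -> edge_density H e = edge_density G e.
Proof.
move=> eH; have [sH tH l0] := wfH eH.
have [f pf] := exists_vpotential wfH (connected_vconnected cH) sH tH.
have dH := edge_densityE wfH eH pf.
have := edge_density_retract wfG sub edge_end_retract piE eH pf.
rewrite -dH; have [_ _ _ <-] := sub_edge eH.
by move/(mulIf (lt0r_neq0 l0)).
Qed.

Lemma sum_density : \sum_(e in edges G) edge_density G e * len G e = (b1 G)%:R.
Proof.
have sGG : subgraph G G by split=> // e _.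
apply: (foster_density (rho := id) wfG sGG wfG (connected_vconnected cG) (connected_verts cG)) => // e -> //.
Qed.

End Retraction.

(** * The induced polarization *)

Lemma fsbig_filter (S : Type) (idx : S) (op : Monoid.com_law idx) (T : choiceType)
    (D : set T) (Q : pred T) (r : seq T) (F : T -> S) : uniq r ->
  (forall i, D i -> i \notin r -> F i = idx) -> {in r, forall i, D i <-> Q i} ->
  \big[op/idx]_(i \in D) F i = \big[op/idx]_(i <- r | Q i) F i.
Proof.
move=> ur Fidx DQ; rewrite -[D in LHS]set_mem_set -(bigfs _ ur); last first.
  by move=> i; rewrite inE; exact: Fidx.
rewrite big_seq_cond [RHS]big_seq_cond; apply: eq_bigl => i.
by case: (boolP (i \in r)) => //= ir; apply/idP/idP; rewrite inE => /(DQ i ir).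
Qed.

Lemma sum_fibres (S : nzRingType) (T U : eqType) (s : seq T) (t : seq U) (r : T -> U)
    (w : T -> S) (f : U -> S) : uniq t -> {in s, forall x, r x \in t} ->
  \sum_(A <- t) (\sum_(x <- s | r x == A) w x) * f A = \sum_(x <- s) w x * f (r x).
Proof.
move=> ut rt; under eq_bigr => A _ do rewrite big_mkcond mulr_suml.
rewrite exchange_big /= big_seq [RHS]big_seq; apply: eq_bigr => x /rt xt.
rewrite (bigD1_seq (r x)) //= eqxx big1 ?addr0 // => A; rewrite eq_sym => /negPf ->.
by rewrite mul0r.
Qed.

Section InducedPolarization.
Variables (R : realType) (V E : finType) (G H : mgraph R V E) (pi : V -> V).
Variable q : gpoint R V E -> nat.
Hypotheses (polG : polarized G q) (cH : connected_mgraph H) (retr : retraction G H pi).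
Implicit Types (A p x : gpoint R V E).

Let cG : connected_mgraph G. Proof. by case: polG. Qed.
Let wfG : well_formed G. Proof. by case: cG. Qed.
Let piH : {in verts H, forall v, pi v = v}. Proof. by case: retr. Qed.

Local Notation ret := (retract G H pi).
Local Notation qH := (induced_q G q H).

(* All vertices are included so that, like q, the canonical divisor vanishes
   outside P. *)
Definition support_list (P : seq (gpoint R V E)) :=
  [/\ uniq P, {in P, forall x, pts G x}, forall v, v \in verts G -> inl v \in P
    & forall x, pts G x -> x \notin P -> q x = 0%N].

Lemma exists_support_list : exists P, support_list P.
Proof.
have [_ fq _] := polG.
have fV : finite_set [set x : gpoint R V E | exists2 v, v \in verts G & x = inl v].
  apply: (@sub_finite_set _ _ [set` [seq (inl v : gpoint R V E) | v <- enum (verts G)]]).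
    by move=> x [v vG ->] /=; apply/mapP; exists v; rewrite ?mem_enum.
  exact: finite_seq.
set Z := [set x | pts G x /\ q x <> 0%N] in fq *; set W := [set x | _] in fV.
have fZW : finite_set (Z `|` W) by rewrite finite_setU.
have /finite_seqP[s Es] := fZW.
have memP x : x \in undup s <-> (Z `|` W) x by rewrite mem_undup Es.
exists (undup s); split.
- exact: undup_uniq.
- by move=> x /memP[[]//|[v vG ->]].
- by move=> v vG; apply/memP; right; exists v.
- move=> x Gx /negP xs; apply: contrapT => qx.
  by apply/xs/memP; left.
Qed.

Section SupportList.
Variable P : seq (gpoint R V E).
Hypothesis suppP : support_list P.
Let uP : uniq P. Proof. by case: suppP. Qed.
Let PG : {in P, forall x, pts G x}. Proof. by case: suppP. Qed.
Let VP v : v \in verts G -> inl v \in P. Proof. by case: suppP => _ _ + _; exact. Qed.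
Let qP x : pts G x -> x \notin P -> q x = 0%N. Proof. by case: suppP => _ _ _; exact. Qed.

Let P' := undup (map ret P).
Let uP' : uniq P'. Proof. exact: undup_uniq. Qed.

Lemma mem_ret_support x : x \in P -> ret x \in P'.
Proof. by move=> xP; rewrite mem_undup map_f. Qed.

Lemma support_pts A : A \in P' -> pts H A.
Proof. by rewrite mem_undup => /mapP[x /PG Gx ->]; exact: retract_pts. Qed.

Lemma verts_support a : a \in verts H -> inl a \in P'.
Proof.
move=> aH; rewrite mem_undup; apply/mapP; exists (inl a); last by rewrite /= piH.
exact/VP/(sub_pts retr (p := inl a)).
Qed.

Lemma fibre_notin A x : A \notin P' -> x \in P -> (ret x == A) = false.
Proof. by move=> AP xP; apply/eqP => rA; rewrite -rA mem_ret_support in AP. Qed.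

Lemma fibre_sum_notin (S : nmodType) (F : gpoint R V E -> S) A : A \notin P' ->
  \sum_(x <- P | ret x == A) F x = 0.
Proof.
by move=> AP; rewrite big_seq_cond big_pred0 // => x; case: (boolP (x \in P)) => //= /(fibre_notin AP).
Qed.

Lemma induced_qE A : pts H A ->
  qH A = (\sum_(x <- P | ret x == A) q x + b1 (subgraph_of G (branch G H A)))%N.
Proof.
move=> HA; rewrite /induced_q; congr (_ + _)%N.
apply: fsbig_filter => //; rewrite (branchE cG cH retr) //.
  by move=> i [Gi _]; exact: qP.
by move=> i /PG Gi /=; split=> [[_ ->]|/eqP].
Qed.

Lemma b1_branch_notin A : pts H A -> A \notin P' -> b1 (subgraph_of G (branch G H A)) = 0%N.
Proof.
case: A => [a aH|[e t] HA _]; first by rewrite verts_support.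
by apply: b1_no_edges; apply/setP => e'; rewrite (branch_edges cG cH retr) // !andbF inE.
Qed.

Lemma induced_q_notin A : pts H A -> A \notin P' -> qH A = 0%N.
Proof.
move=> HA AP; rewrite induced_qE // b1_branch_notin // addn0.
by rewrite big_seq_cond big_pred0 // => x; case: (boolP (x \in P)) => //= /(fibre_notin AP).
Qed.

Lemma sum_pts_support (S : nmodType) (F : gpoint R V E -> S) :
  (forall x, pts G x -> x \notin P -> F x = 0) ->
  \sum_(x \in pts G) F x = \sum_(x <- P) F x.
Proof. by move=> F0; apply: fsbig_filter => // x /PG. Qed.

Lemma sum_sub_support (S : nmodType) (F : gpoint R V E -> S) :
  (forall x, pts H x -> x \notin P' -> F x = 0) ->
  \sum_(x \in pts H) F x = \sum_(x <- P') F x.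
Proof. by move=> F0; apply: fsbig_filter => // x /support_pts. Qed.

(** The second sum comes from the [b1] of the branches: each edge outside H lies in exactly one
    branch and is collapsed to its root. *)
Lemma push_q (f : gpoint R V E -> R) :
  \sum_(A \in pts H) (qH A)%:R * f A = \sum_(x \in pts G) (q x)%:R * f (ret x)
  + \sum_(e in edges G | e \notin edges H) edge_density G e * len G e * f (inl (pi (src G e))).
Proof.
rewrite sum_pts_support => [|x Gx xP]; last by rewrite qP // mul0r.
rewrite sum_sub_support => [|x Gx xP]; last by rewrite induced_q_notin // mul0r.
transitivity (\sum_(A <- P') (\sum_(x <- P | ret x == A) (q x)%:R) * f A
  + \sum_(A <- P') (\sum_(e | [&& e \in edges G, e \notin edges H & inl (pi (src G e)) == A])
     edge_density G e * len G e) * f A).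
  rewrite -big_split [LHS]big_seq [RHS]big_seq; apply: eq_bigr => A /support_pts HA /=.
  by rewrite induced_qE // natrD mulrDl natr_sum (b1_branch cG cH retr).
rewrite sum_fibres //; last exact: mem_ret_support.
congr (_ + _); under eq_bigr => A _ do rewrite mulr_suml big_mkcond.
rewrite exchange_big /= [RHS]big_mkcond; apply: eq_bigr => e _.
case: (boolP (e \in edges G)) => eG; last by rewrite big1.
case: (boolP (e \in edges H)) => eH /=; first by rewrite big1.
have [sG _ _] := wfG eG.
have sP : inl (pi (src G e)) \in P' by exact: mem_ret_support (VP sG).
rewrite (bigD1_seq _ sP) //= eqxx big1 ?addr0 // => A; rewrite eq_sym.
by move/negPf ->.
Qed.

(** This is [push_q] for f = 1, read in R because densities are real. The edges of H, of mass
    b_1(H), complete the second sum to the sum over all edges of G, which is b_1(G). *)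
Lemma induced_genus : genus H qH = genus G q.
Proof.
apply/eqP; rewrite -(eqr_nat R) /genus !natrD; apply/eqP.
have sumR (X : mgraph R V E) (q' : gpoint R V E -> nat) Q :
    uniq Q -> {in Q, forall x, pts X x} -> (forall x, pts X x -> x \notin Q -> q' x = 0%N) ->
    (\big[addn/0%N]_(x \in pts X) q' x)%:R = \sum_(x \in pts X) ((q' x)%:R * 1 : R).
  move=> uQ QX q0; rewrite (@fsbig_filter _ _ _ _ _ xpredT Q) //; last by move=> x /QX.
  rewrite (@fsbig_filter _ _ _ _ _ xpredT Q) //; last by move=> x /QX.
    by rewrite natr_sum; apply: eq_bigr => x _; rewrite mulr1.
  by move=> x Xx xQ; rewrite q0 // mul0r.
rewrite (sumR H qH P') //; [|exact: support_pts|exact: induced_q_notin].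
rewrite (sumR G q P) // (push_q (fun=> 1)) -addrA; congr (_ + _).
rewrite -(sum_density cG) -(sum_density cH) [RHS](bigID (mem (edges H))) /= addrC.
congr (_ + _); last by apply: eq_bigr => e _; rewrite mulr1.
transitivity (\sum_(e in edges H) edge_density G e * len G e).
  apply: eq_bigr => e eH; rewrite (edge_density_sub cG cH retr) //.
  by have [_ _ _ ->] := sub_edge retr eH.
apply: eq_bigl => e; case: (boolP (e \in edges H)) => [eH|]; last by rewrite andbF.
by have [-> _ _ _] := sub_edge retr eH.
Qed.

(** Serves for the valence minus 2, which vanishes at all interior points of edges. *)
Lemma sum_verts_support (S : nmodType) (Q : pred (gpoint R V E)) (F : gpoint R V E -> S) :
  (forall z, F (inr z) = 0) ->
  \sum_(x <- P | Q x) F x = \sum_(v in verts G | Q (inl v)) F (inl v).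
Proof.
move=> F0; pose isl (x : gpoint R V E) := if x is inl _ then true else false.
rewrite (bigID isl) /= [X in _ + X]big1 ?addr0; last by case=> [v|z _]; rewrite ?andbF // F0.
transitivity (\sum_(x <- [seq (inl v : gpoint R V E) | v <- enum (verts G)] | Q x) F x).
  under eq_bigl do rewrite andbC; rewrite -big_filter_cond.
  apply: perm_big; apply: uniq_perm; first exact: filter_uniq.
    by rewrite map_inj_uniq ?enum_uniq // => u v [].
  move=> x; rewrite mem_filter; apply/andP/mapP => [[]|[v]].
    by case: x => // v _ /PG /= vG; exists v; rewrite ?mem_enum.
  by rewrite mem_enum => /VP vP ->.
by rewrite big_map big_enum_cond.
Qed.

Lemma sum_card_fibres (W : {set V}) (D : {set E}) (s : E -> V) :
  (\sum_(v in W) #|[set e in D | s e == v]%SET| = #|[set e in D | s e \in W]%SET|)%N.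
Proof.
rewrite -sum1dep_card (partition_big s (mem W)) => [|e /andP[]//] /=.
apply: eq_bigr => v vW; rewrite -sum1dep_card; apply: eq_bigl => e.
by case: eqP => [->|_]; rewrite ?vW ?andbT ?andbF.
Qed.

(** An edge of the branch is counted at both its ends; the other half-edges at vertices of the
    branch are those of H at a. *)
Lemma branch_valence a : a \in verts H ->
  let B := subgraph_of G (branch G H (inl a)) in
  (\sum_(v in verts B) valence G (inl v) = valence H (inl a) + #|edges B|.*2)%N.
Proof.
move=> aH B.
have count (s sH : E -> V) : {in edges H, sH =1 s} ->
    (forall e, e \in edges G -> s e \in verts G) ->
    (forall e, e \in edges H -> pi (s e) = s e) ->
    (forall e, e \in edges G -> e \notin edges H -> pi (s e) = pi (src G e)) ->
  (\sum_(v in verts B) #|[set e in edges G | s e == v]%SET|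
   = #|[set e in edges H | sH e == a]%SET| + #|edges B|)%N.
  move=> sHs sG psH psG; rewrite sum_card_fibres.
  have -> : [set e in edges G | s e \in verts B]%SET = ([set e in edges H | sH e == a] :|: edges B)%SET.
    apply/setP => e; rewrite finset.in_setU (branch_edges cG cH retr) //.
    rewrite [LHS]finset.in_set [e \in [set _ in _ | _]%SET]finset.in_set.
    rewrite (branch_verts cG cH retr) //.
    case: (boolP (e \in edges H)) => eH /=.
      have [eG _ _ _] := sub_edge retr eH.
      by rewrite eG /= sG // psH // sHs // orbF.
    by case: (boolP (e \in edges G)) => //= eG; rewrite sG // psG.
  suff I0 : ([set e in edges H | sH e == a] :&: edges B)%SET = finset.set0.
    by rewrite cardsU I0 cards0 subn0.
  apply/setP => e; rewrite finset.in_setI (branch_edges cG cH retr) // !finset.inE.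
  by case: (e \in edges H); rewrite /= ?andbF ?andbF.
rewrite -addnn addnACA big_split /=; congr (_ + _)%N; apply: count.
- by move=> e /(sub_edge retr)[].
- by move=> e /wfG[].
- by move=> e /(edge_end_retract cH retr)[].
- by [].
- by move=> e /(sub_edge retr)[].
- by move=> e /wfG[].
- by move=> e /(edge_end_retract cH retr)[].
- by move=> e eG eH; case: retr => _ _ _ ->.
Qed.

(** Summing valence minus 2 over the branch B at a vertex a gives val_H(a) + 2|E(B)| - 2|V(B)|,
    which is val_H(a) + 2 b_1(B) - 2 because B is connected. Over an interior point of an edge of H
    the branch has no vertex and no edge, and both valence terms are 0. *)
Lemma induced_canonical A : pts H A ->
  canonical_div H qH A = \sum_(x <- P | ret x == A) canonical_div G q x.
Proof.
move=> HA; rewrite {1}/canonical_div induced_qE //.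
transitivity (\sum_(x <- P | ret x == A) ((valence G x)%:Z - 2)
  + \sum_(x <- P | ret x == A) 2 * (q x)%:Z); last first.
  by rewrite -big_split; apply: eq_bigr => x _; rewrite /canonical_div /=; ring.
rewrite [\sum_(x <- P | _) (_ - 2)](sum_verts_support (fun x => ret x == A)) //.
rewrite -mulr_sumr -(big_morph Posz PoszD erefl).
case: A HA => [a aH|[e t] HA]; last first.
  have -> : b1 (subgraph_of G (branch G H (inr (e, t)))) = 0%N.
    by apply: b1_no_edges; apply/setP => e'; rewrite (branch_edges cG cH retr) // !andbF inE.
  rewrite [\sum_(v in verts G | _) _]big_pred0; last by move=> v; apply/andP => -[_ /eqP].
  by rewrite addn0 /=; ring.
set B := subgraph_of _ _.
have -> : \sum_(v in verts G | ret (inl v) == inl a) ((valence G (inl v))%:Z - 2)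
    = \sum_(v in verts B) ((valence G (inl v))%:Z - 2).
  by apply: eq_bigl => v; rewrite (branch_verts cG cH retr) //.
rewrite sumrB -(big_morph Posz PoszD erefl) (branch_valence aH) -/B sumr_const.
have := b1_connected (branch_wf cG cH retr aH) (branch_vconnected cG cH retr aH)
  (branch_nonempty cG cH retr aH).
rewrite -/B; move: (\sum_(x <- P | _) q x)%N (valence H _) (b1 B) #|edges B| #|verts B|.
move=> a1 a2 a3 a4 a5.
by lia.
Qed.

Lemma canonical_notin x : pts G x -> x \notin P -> canonical_div G q x = 0.
Proof.
by move=> Gx xP; rewrite /canonical_div qP //; case: x Gx xP => [v /VP ->|z _ _] //=.
Qed.

Lemma push_canonical (f : gpoint R V E -> R) :
  \sum_(A \in pts H) (canonical_div H qH A)%:~R * f A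
  = \sum_(x \in pts G) (canonical_div G q x)%:~R * f (ret x).
Proof.
rewrite sum_pts_support => [|x Gx xP]; last by rewrite canonical_notin // mul0r.
rewrite sum_sub_support => [|x Gx xP]; last by rewrite induced_canonical // fibre_sum_notin // mul0r.
rewrite -(@sum_fibres _ _ _ P P' ret (fun x => (canonical_div G q x)%:~R) f) //; last exact: mem_ret_support.
rewrite big_seq [RHS]big_seq; apply: eq_bigr => A /support_pts HA.
by rewrite induced_canonical // rmorph_sum.
Qed.

Lemma induced_polarized : polarized H qH.
Proof.
split=> //.
  apply: (@sub_finite_set _ _ [set` P']); last exact: finite_seq.
  by move=> A /= [HA qA]; apply/negPn/negP => AP; apply: qA; exact: induced_q_notin.
move=> A HA; rewrite induced_canonical // big_seq_cond; apply: sumr_ge0 => x /andP[/PG Gx _].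
by have [_ _] := polG; exact.
Qed.

End SupportList.
End InducedPolarization.

(** * Integration on edges and graphs *)

Section SegmentIntegrals.
Variable R : realType.
Implicit Types (F : R -> R) (l : R).
Local Notation leb := (@lebesgue_measure R).

Lemma lipschitz_integrable F l (C : R) :
  (forall s t, 0 <= s <= l -> 0 <= t <= l -> `|F s - F t| <= C * `|s - t|) ->
  leb.-integrable `[0, l] (EFin \o F).
Proof.
move=> FC; apply: continuous_compact_integrable; first exact: segment_compact.
apply/subspace_continuousP => s; rewrite /= in_itv /= => s0l.
apply/cvgrPdist_le => e e0 /=.
(* The sign of C is unknown, whence a denominator that is positive in all cases. *)
have C0 : 0 < `|C| + 1 by rewrite ltr_wpDl.
have : \forall t \near nbhs s, `|s - t| <= e / (`|C| + 1).
  apply/nbhs_ballP; exists (e / (`|C| + 1)); first exact: divr_gt0.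
  by move=> t; rewrite -ball_normE => /ltW.
apply: filterS => t /= st; rewrite in_itv /= => t0l.
apply: le_trans (FC s t s0l t0l) _.
rewrite ler_pdivlMr // in st.
by apply: le_trans st; rewrite mulrC ler_wpM2l // (le_trans (ler_norm C)) // lerDl ler01.
Qed.

Lemma segment_integral_cst l (c : R) : 0 <= l -> \int[leb]_(t in `[0, l]) c = c * l.
Proof.
move=> l0; rewrite Rintegral_cst //; congr (_ * _).
rewrite [X in fine X]lebesgue_measure_itv /= lte_fin; case: ifPn => [_ /=|]; first by rewrite subr0.
by rewrite -leNgt => l0'; apply/le_anti; rewrite l0 l0'.
Qed.

Lemma segment_integral_dist F F' l (K : R) : 0 <= l ->
  leb.-integrable `[0, l] (EFin \o F) -> leb.-integrable `[0, l] (EFin \o F') ->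
  (forall t, 0 <= t <= l -> `|F t - F' t| <= K) ->
  `|\int[leb]_(t in `[0, l]) F t - \int[leb]_(t in `[0, l]) F' t| <= l * K.
Proof.
move=> l0 iF iF' FK; rewrite -RintegralB //.
have iB : leb.-integrable `[0, l] (EFin \o (fun t => F t - F' t)).
  by have := integrableB _ iF iF'; apply.
apply: le_trans (le_normr_Rintegral _ iB) _ => //.
rewrite [leRHS]mulrC -segment_integral_cst //; apply: le_Rintegral => //.
- by have := integrable_norm iB.
- by apply: (@lipschitz_integrable _ _ 0) => s t _ _; rewrite subrr normr0 mul0r.
Qed.

Lemma segment_integral_sum (I : Type) (r : seq I) (F : I -> R -> R) l : 0 <= l ->
  (forall i, leb.-integrable `[0, l] (EFin \o F i)) ->
  \int[leb]_(t in `[0, l]) (\sum_(i <- r) F i t) = \sum_(i <- r) \int[leb]_(t in `[0, l]) F i t.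
Proof.
move=> l0 iF; elim: r => [|i r IH].
  rewrite big_nil; under eq_Rintegral => t _ do rewrite big_nil.
  by rewrite segment_integral_cst // mul0r.
rewrite big_cons -IH -RintegralD //; first by apply: eq_Rintegral => t _; rewrite big_cons.
apply: (@eq_integrable _ _ _ leb `[0, l] _ (fun t => \sum_(i <- r) (F i t)%:E)%E) => //.
  by move=> t _ /=; rewrite sumEFin.
by apply: integrable_sum => // j _; exact: iF.
Qed.

End SegmentIntegrals.

Section GraphIntegrals.
Variables (R : realType) (V E : finType).
Implicit Types (G H : mgraph R V E) (m : gmeasure R V E) (f g : gpoint R V E -> R).
Local Notation leb := (@lebesgue_measure R).

(** The atomic part of [gintegral] is a sum over an infinite set, equal to 0 by convention if the
    support is infinite; finiteness is what makes it linear. *)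
Definition finite_atoms G m := exists P : seq (gpoint R V E),
  [/\ uniq P, {in P, forall x, pts G x} & forall x, pts G x -> x \notin P -> atom m x = 0].

Definition edge_lipschitz G f := forall e, e \in edges G -> exists C : R,
  forall s t, 0 <= s <= len G e -> 0 <= t <= len G e ->
    `|f (pt G e s) - f (pt G e t)| <= C * `|s - t|.

Lemma edge_lipschitz_integrable G f e : edge_lipschitz G f -> e \in edges G ->
  leb.-integrable `[0, len G e] (EFin \o (fun t => f (pt G e t))).
Proof. by move=> fL /fL[C /lipschitz_integrable]. Qed.

Lemma eq_gintegral G m f g : well_formed G -> (forall x, pts G x -> f x = g x) ->
  gintegral G m f = gintegral G m g.
Proof.
move=> wfG fg; congr (_ + _); first by apply: eq_fsbigr => x; rewrite inE => /fg ->.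
apply: eq_bigr => e eG; congr (_ * _); apply: eq_Rintegral => t.
by rewrite inE /= in_itv /= => t0l; apply: fg; exact: pts_pt.
Qed.

Lemma atoms_sum G m f P : uniq P -> {in P, forall x, pts G x} ->
  (forall x, pts G x -> x \notin P -> atom m x = 0) ->
  \sum_(x \in pts G) (atom m x * f x) = \sum_(x <- P) atom m x * f x.
Proof.
move=> uP PG m0; apply: fsbig_filter => // [x Gx xP|x /PG //].
by rewrite m0 // mul0r.
Qed.

Lemma gintegral_addm G m m' f : finite_atoms G m -> finite_atoms G m' ->
  gintegral G (addm m m') f = gintegral G m f + gintegral G m' f.
Proof.
case=> P [uP PG m0] [P' [uP' PG' m0']].
pose Q := undup (P ++ P').
have QG : {in Q, forall x, pts G x}.
  by move=> x; rewrite mem_undup mem_cat => /orP[/PG|/PG'].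
have Q0 : forall x, pts G x -> x \notin Q -> atom m x = 0.
  by move=> x Gx; rewrite mem_undup mem_cat negb_or => /andP[/m0 ->].
have Q0' : forall x, pts G x -> x \notin Q -> atom m' x = 0.
  by move=> x Gx; rewrite mem_undup mem_cat negb_or => /andP[_ /m0' ->].
rewrite /gintegral !(@atoms_sum G _ _ Q) ?undup_uniq //; last first.
  by move=> x Gx xQ /=; rewrite Q0 // Q0' // addr0.
rewrite addrACA -!big_split; congr (_ + _); apply: eq_bigr => z _ /=; first exact: mulrDl.
by rewrite mulrDl.
Qed.

Lemma finite_atoms_scale G m (c : R) : finite_atoms G m -> finite_atoms G (scalem c m).
Proof. by case=> P [uP PG m0]; exists P; split=> // x Gx xP /=; rewrite m0 // mulr0. Qed.

Lemma gintegral_scalem G m f (c : R) : finite_atoms G m ->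
  gintegral G (scalem c m) f = c * gintegral G m f.
Proof.
move=> fm; have [P [uP PG m0]] := fm; rewrite /gintegral !(@atoms_sum G _ _ P) //; last first.
  by move=> x Gx xP /=; rewrite m0 // mulr0.
by rewrite mulrDr !mulr_sumr; congr (_ + _); apply: eq_bigr => z _ /=; rewrite mulrA.
Qed.

Lemma gintegral_sum G m n (f : 'I_n -> gpoint R V E -> R) : well_formed G -> finite_atoms G m ->
  (forall i, edge_lipschitz G (f i)) ->
  gintegral G m (fun x => \sum_(i < n) f i x) = \sum_(i < n) gintegral G m (f i).
Proof.
move=> wfG [P [uP PG m0]] fL; rewrite /gintegral big_split /=; congr (_ + _).
  rewrite (atoms_sum _ uP PG m0); under [RHS]eq_bigr do rewrite (atoms_sum _ uP PG m0).
  by rewrite exchange_big; apply: eq_bigr => x _; rewrite mulr_sumr.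
rewrite exchange_big; apply: eq_bigr => e eG; rewrite -mulr_sumr; congr (_ * _).
have [_ _ l0] := wfG e eG; apply: segment_integral_sum; first exact: ltW.
by move=> i; exact: edge_lipschitz_integrable.
Qed.

(** M is the total variation of m. It does not depend on f and g, so integrating the resistance in
    one variable keeps it Lipschitz in the other. *)
Lemma gintegral_dist G m : well_formed G -> finite_atoms G m -> exists M : R, 0 <= M /\
  forall f g (K : R), edge_lipschitz G f -> edge_lipschitz G g ->
    (forall x, pts G x -> `|f x - g x| <= K) ->
    `|gintegral G m f - gintegral G m g| <= M * K.
Proof.
move=> wfG [P [uP PG m0]].
exists (\sum_(x <- P) `|atom m x| + \sum_(e in edges G) `|dens m e| * len G e); split.
  apply: addr_ge0; first exact: sumr_ge0.
  by apply: sumr_ge0 => e eG; have [_ _ l0] := wfG e eG; rewrite mulr_ge0 ?(ltW l0).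
move=> f g K fL gL fg; rewrite /gintegral !(atoms_sum _ uP PG m0).
rewrite opprD addrACA -!sumrB mulrDl !mulr_suml.
apply: le_trans (ler_normD _ _) _; apply: lerD.
  rewrite big_seq [leRHS]big_seq; apply: le_trans (ler_norm_sum _ _ _) _.
  apply: ler_sum => x /PG Gx; rewrite -mulrBr normrM ler_wpM2l // fg //.
apply: le_trans (ler_norm_sum _ _ _) _; apply: ler_sum => e eG.
have [_ _ l0] := wfG e eG; rewrite -mulrBr normrM -mulrA ler_wpM2l //.
apply: segment_integral_dist; [exact: ltW|exact: edge_lipschitz_integrable|
  exact: edge_lipschitz_integrable|].
by move=> t t0l; apply: fg; exact: pts_pt.
Qed.

Lemma admissible_atoms G q : polarized G q -> finite_atoms G (admissible G q).
Proof.
move=> polG; have [P [uP PG _ q0]] := exists_support_list polG.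
by exists P; split=> // x Gx xP /=; rewrite q0 // mulr0.
Qed.

Lemma delta_K_atoms G q : polarized G q -> finite_atoms G (delta_K G q).
Proof.
move=> polG; have [P suppP] := exists_support_list polG; have [uP PG _ _] := suppP.
by exists P; split=> // x Gx xP /=; rewrite (canonical_notin suppP).
Qed.

Definition mean_resistance G q (x : gpoint R V E) : R :=
  gintegral G (admissible G q) (fun y => resistance G x y).

Lemma resistance_edge_lipschitz G x : connected_mgraph G -> pts G x ->
  edge_lipschitz G (resistance G x).
Proof.
move=> cG Gx e eG; have wfG : well_formed G by case: cG.
have [C CP] := resistance_lipschitz wfG (connected_vconnected cG) eG.
by exists C => s t s0l t0l; have [] := CP x s t Gx s0l t0l.
Qed.

Lemma mean_resistance_lipschitz G q : polarized G q -> edge_lipschitz G (mean_resistance G q).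
Proof.
move=> polG e eG; have [cG _ _] := polG; have wfG : well_formed G by case: cG.
have [C CP] := resistance_lipschitz wfG (connected_vconnected cG) eG.
have [M [M0 MP]] := gintegral_dist wfG (admissible_atoms polG).
exists (M * C) => s t s0l t0l; rewrite -mulrA; apply: MP.
- by apply: resistance_edge_lipschitz => //; exact: pts_pt.
- by apply: resistance_edge_lipschitz => //; exact: pts_pt.
by move=> x Gx; have [_] := CP x s t Gx s0l t0l.
Qed.

Lemma edge_lipschitzB G f (c : R) : edge_lipschitz G f -> edge_lipschitz G (fun x => f x - c).
Proof.
move=> fL e /fL[C CP]; exists C => s t s0l t0l.
by rewrite opprB addrA addrNK CP.
Qed.

End GraphIntegrals.

(** * Images of the admissible measure and of the canonical divisor under a retraction *)

Section Push.
Variables (R : realType) (V E : finType) (G H : mgraph R V E) (pi : V -> V).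
Variable q : gpoint R V E -> nat.
Hypotheses (polG : polarized G q) (cH : connected_mgraph H) (retr : retraction G H pi).
Implicit Types (f : gpoint R V E -> R).
Local Notation ret := (retract G H pi).
Local Notation qH := (induced_q G q H).
Let cG : connected_mgraph G. Proof. by case: polG. Qed.
Let wfG : well_formed G. Proof. by case: cG. Qed.

Lemma edge_lipschitz_push f : edge_lipschitz H f -> edge_lipschitz G (f \o ret).
Proof.
move=> fL e eG; case: (boolP (e \in edges H)) => eH; last first.
  by exists 0 => s t s0l t0l /=; rewrite !(retract_pt_out retr) // subrr normr0 mul0r.
have [C CP] := fL e eH; exists C => s t s0l t0l /=.
have [_ _ _ El] := sub_edge retr eH.
by rewrite !(retract_pt_in cH retr) // -!(sub_pt retr) // CP // El.
Qed.

(* Foster's theorem gives the branches their mass, so that the induced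
   admissible measure is the image of the admissible measure. *)
Lemma gintegral_push f :
  gintegral H (admissible H qH) f = gintegral G (admissible G q) (f \o ret).
Proof.
have [P suppP] := exists_support_list polG.
have gE := induced_genus polG cH retr suppP.
set w := ((genus G q)%:R)^-1 : R.
have pH := induced_polarized polG cH retr suppP.
have -> : gintegral H (admissible H qH) f = w * gintegral H
    (GMeasure (fun x => (qH x)%:R) (edge_density H)) f.
  rewrite /w -gE -gintegral_scalem //.
  have [P' [uP' PH _ q0]] := exists_support_list pH.
  by exists P'; split=> // x Hx xP' /=; rewrite q0.
have -> : gintegral G (admissible G q) (f \o ret) = w * gintegral G
    (GMeasure (fun x => (q x)%:R) (edge_density G)) (f \o ret).
  rewrite -gintegral_scalem //; have [uP PG _ q0] := suppP.
  by exists P; split=> // x Gx xP /=; rewrite q0.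
congr (_ * _); rewrite /gintegral /= (push_q polG cH retr suppP) -addrA; congr (_ + _).
(* On an edge outside H the function f \o ret is constant, so its integral is the value at the root
   times the length: this is the second sum of [push_q]. *)
rewrite [RHS](bigID (mem (edges H))) /= addrC; congr (_ + _); last first.
  apply: eq_bigr => e /andP[eG eH]; have [_ _ l0] := wfG eG.
  rewrite -mulrA; congr (_ * _); rewrite mulrC -segment_integral_cst ?(ltW l0) //.
  apply: eq_Rintegral => t; rewrite inE /= in_itv /= => t0l.
  by rewrite (retract_pt_out retr).
transitivity (\sum_(e in edges H) edge_density G e
    * \int[lebesgue_measure]_(t in `[0, len G e]) f (ret (pt G e t))).
  apply: eq_bigr => e eH; rewrite (edge_density_sub cG cH retr) //; congr (_ * _).
  have [_ _ _ ->] := sub_edge retr eH.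
  apply: eq_Rintegral => t; rewrite inE /= in_itv /= => t0l.
  by rewrite (retract_pt_in cH retr) // (sub_pt retr).
apply: eq_bigl => e; case: (boolP (e \in edges H)) => [eH|]; last by rewrite andbF.
by have [-> _ _ _] := sub_edge retr eH.
Qed.

Lemma gintegral_push_K f : gintegral H (delta_K H qH) f = gintegral G (delta_K G q) (f \o ret).
Proof.
have [P suppP] := exists_support_list polG.
rewrite /gintegral /= [X in _ + X = _]big1 => [|e _]; last by rewrite mul0r.
rewrite [X in _ = _ + X]big1 => [|e _]; last by rewrite mul0r.
rewrite !addr0; exact: push_canonical suppP f.
Qed.

End Push.

(** * Pointed sums *)

Section PointedSum.
Variables (R : realType) (V E : finType) (G : mgraph R V E) (m : nat) (H : 'I_m -> mgraph R V E).
Hypotheses (wfG : well_formed G) (subH : forall i, subgraph (H i) G).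
Hypotheses (sumH : successive_pointed_sum G H).

Let unionH p : pts G p <-> exists i, pts (H i) p.
Proof.
by case: sumH => <- _; split=> [[i _ Hp]|[i Hp]]; exists i.
Qed.

Let edge_in e i t : e \in edges (H i) -> 0 < t < len G e -> pts (H i) (inr (e, t)).
Proof. by move=> eH t0l /=; have [_ _ /(_ e eH)[_ _ ->]] := subH i; rewrite eH. Qed.

Lemma pointed_sum_edge_lt e (i j : 'I_m) : (i < j)%N -> e \in edges (H i) -> e \notin edges (H j).
Proof.
move=> ij eHi; apply/negP => eHj.
have [_ /fintype.subsetP/(_ e eHi)/wfG[_ _ l0] _] := subH i.
have [A AE] := sumH.2 j (leq_ltn_trans (leq0n i) ij).
have inA t : 0 < t < len G e -> inr (e, t) = A.
  move=> t0l; suff : [set A] (inr (e, t)) by [].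
  by rewrite -AE; split; [exists i => //|]; exact: edge_in.
(* Two distinct interior points of a common edge would both be the gluing point. *)
have h1 : 0 < len G e / 2 < len G e by lra.
have h2 : 0 < len G e / 3 < len G e by lra.
have := inA _ h1; rewrite -(inA _ h2) => -[E2].
by move: E2 => /eqP; apply/negP/eqP; lra.
Qed.

Lemma pointed_sum_edges e : e \in edges G -> exists j, forall i, (e \in edges (H i)) = (i == j).
Proof.
move=> eG; have [_ _ l0] := wfG eG.
(* The midpoint of e lies in some piece, which, being a subgraph of the model, contains the whole
   edge e. *)
have [j /andP[ej _]] : exists i, pts (H i) (inr (e, len G e / 2)).
  by apply/unionH; rewrite /= eG /=; lra.
exists j => i; case: eqP => [->//|ij]; apply/negP => ei.
have : i != j :> nat by apply/eqP => /ord_inj.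
rewrite neq_ltn => /orP[lt|lt].
  by have := pointed_sum_edge_lt lt ei; rewrite ej.
by have := pointed_sum_edge_lt lt ej; rewrite ei.
Qed.

Lemma gluing_vertex (i : 'I_m) : (0 < i)%N -> exists a : V, [/\ a \in verts (H i),
  exists2 j : 'I_m, (j < i)%N & a \in verts (H j)
  & forall v (j : 'I_m), (j < i)%N -> v \in verts (H i) -> v \in verts (H j) -> v = a].
Proof.
move=> i0; have [A AE] := sumH.2 i i0.
have [[j /= ji HjA] HiA] : ((\bigcup_(j in [set j : 'I_m | (j < i)%N]) pts (H j)) `&` pts (H i)) A.
  by rewrite AE.
case: A AE HjA HiA => [a|[e t]] AE /= HjA HiA; last first.
  case/andP: HjA => ej _; case/andP: HiA => ei _.
  by have := pointed_sum_edge_lt ji ej; rewrite ei.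
exists a; split=> //; first by exists j.
move=> v k ki vi vk; suff : [set (inl a : gpoint R V E)] (inl v) by case.
by rewrite -AE; split=> //; exists k.
Qed.

(* The retraction onto H i, built one piece at a time: everything glued before
   H i goes to the gluing point of H i, and each later piece to the image of
   its own gluing point. *)
Lemma pointed_sum_retraction_upto (i : 'I_m) (k : nat) : (i < k)%N -> (k <= m)%N ->
  exists pi : V -> V, [/\ {in verts (H i), forall v, pi v = v},
    forall (j : 'I_m) v, (j < k)%N -> v \in verts (H j) -> pi v \in verts (H i)
  & forall (j : 'I_m), (j < k)%N -> j != i ->
      exists b, {in verts (H j), forall v, pi v = b}].
Proof.
move=> ik; have -> : k = ((k - i.+1) + i.+1)%N by rewrite subnK.
elim: (k - i.+1)%N => {ik} [|n IH] km.
  case: (posnP i) => [i0|/gluing_vertex[a [ai _ aE]]].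
    exists id; split=> // [j v|j]; rewrite add0n ltnS i0 leqn0 => /eqP j0.
      by have -> : j = i by apply: ord_inj; rewrite j0 i0.
    by have -> : j = i by [apply: ord_inj; rewrite j0 i0]; rewrite eqxx.
  exists (fun v => if v \in verts (H i) then v else a); split=> [v -> //|j v _ _|j].
    by case: ifP.
  rewrite add0n ltnS leq_eqVlt => /orP[/eqP/ord_inj ->|ji _]; first by rewrite eqxx.
  by exists a => v vj; case: ifP => // vi; exact: aE vj.
have [|pi [pi_id pi_in pi_cst]] := IH; first by apply: leq_trans km; rewrite addSn.
rewrite addSn in km; pose k' : 'I_m := Ordinal km.
have [a [ak [j0 j0k aj0] aE]] := @gluing_vertex k' (leq_trans (ltn0Sn i) (leq_addl _ _)).
(* A vertex of the new piece that is old is the gluing point a, so the two rules below agree on the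
   overlap and the new piece goes entirely to pi a. *)
pose old v := [exists j : 'I_m, (j < n + i.+1)%N && (v \in verts (H j))].
have oldP (j : 'I_m) v : (j < n + i.+1)%N -> v \in verts (H j) -> old v.
  by move=> jk vj; apply/existsP; exists j; rewrite jk.
exists (fun v => if old v then pi v else pi a); split.
- by move=> v vi; rewrite (oldP i) ?pi_id // leq_addl.
- move=> j v; rewrite addSn ltnS leq_eqVlt => /orP[_ _|jk vj].
    case: ifP => [/existsP[j' /andP[j'k vj']]|_]; first exact: pi_in vj'.
    exact: pi_in aj0.
  by rewrite (oldP j) //; exact: pi_in vj.
move=> j; rewrite addSn ltnS leq_eqVlt => /orP[/eqP jk _|jk ji]; last first.
  have [b bP] := pi_cst j jk ji; exists b => v vj.
  by rewrite (oldP j) // bP.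
have {jk} -> : j = k' by exact: ord_inj.
exists (pi a) => v vk; case: ifP => // /existsP[j' /andP[j'k vj']].
by rewrite (aE v j').
Qed.

Lemma pointed_sum_retraction (i : 'I_m) : (forall j, well_formed (H j)) ->
  exists pi, retraction G (H i) pi.
Proof.
move=> wfH; have [pi [pi_id pi_in pi_cst]] := pointed_sum_retraction_upto (ltn_ord i) (leqnn m).
exists pi; split=> // [v vG|e eG ei].
  by have /unionH[j vj] : pts G (inl v) by []; exact: pi_in vj.
have [j ej] := pointed_sum_edges eG; have eHj : e \in edges (H j) by rewrite ej.
have [|b bP] := pi_cst j (ltn_ord j); first by apply/negP => /eqP ji; rewrite ej ji eqxx in ei.
have [sj tj _] := wfH j e eHj; have [_ _ /(_ e eHj)[Es Et _]] := subH j.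
by rewrite -Es -Et !bP.
Qed.

End PointedSum.

(** * Additivity of the effective resistance and of the invariants *)

Section Additivity.
Variables (R : realType) (V E : finType) (G : mgraph R V E) (m : nat) (H : 'I_m -> mgraph R V E).
Variable pi : 'I_m -> V -> V.
Hypotheses (cG : connected_mgraph G) (cH : forall i, connected_mgraph (H i)).
Hypothesis retr : forall i, retraction G (H i) (pi i).
Hypothesis edgesH : forall e, e \in edges G -> exists j, forall i, (e \in edges (H i)) = (i == j).
Implicit Types (x y : gpoint R V E).
Local Notation ret i := (retract G (H i) (pi i)).

Let wfG : well_formed G. Proof. by case: cG. Qed.

Lemma sum_edges (F : E -> R) :
  \sum_(e in edges G) F e = \sum_(i < m) \sum_(e in edges (H i)) F e.
Proof.
under [RHS]eq_bigr do rewrite big_mkcond; rewrite exchange_big /= [LHS]big_mkcond.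
apply: eq_bigr => e _; case: (boolP (e \in edges G)) => eG; last first.
  rewrite big1 // => i _; case: ifP => // /(sub_edge (retr i))[].
  by rewrite (negPf eG).
have [j ej] := edgesH eG; rewrite (bigD1 j) //= ej eqxx big1 ?addr0 // => i ij.
by rewrite ej (negPf ij).
Qed.

Lemma sum_total_length : total_length G = \sum_(i < m) total_length (H i).
Proof.
rewrite /total_length sum_edges; apply: eq_bigr => i _; apply: eq_bigr => e eH.
by have [_ _ _ ->] := sub_edge (retr i) eH.
Qed.

Lemma sum_retract_edge (h : gpoint R V E -> R) e j t : e \in edges G ->
  (forall i, (e \in edges (H i)) = (i == j)) -> 0 <= t <= len G e ->
  \sum_(i < m) h (ret i (pt G e t))
  = h (pt G e t) + \sum_(i < m | i != j) h (inl (pi i (src G e))).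
Proof.
move=> eG ej t0l; rewrite (bigD1 j) //= (retract_pt_in (cH j) (retr j)) ?ej ?eqxx //.
congr (_ + _); apply: eq_bigr => i ij.
by rewrite (retract_pt_out (retr i)) // ej.
Qed.

(** Along an edge only the retraction onto its own piece moves, and there it is the identity; hence
    the difference is constant on each edge, and on G by connectedness. This splits h x - h y over
    the pieces. *)
Lemma sum_retract_const (h : gpoint R V E -> R) x y : pts G x -> pts G y ->
  \sum_(i < m) h (ret i x) - h x = \sum_(i < m) h (ret i y) - h y.
Proof.
pose D x := \sum_(i < m) h (ret i x) - h x.
have De e s t : e \in edges G -> 0 <= s <= len G e -> 0 <= t <= len G e ->
    D (pt G e s) = D (pt G e t).
  by move=> eG s0l t0l; have [j ej] := edgesH eG; rewrite /D !(sum_retract_edge h eG ej) //; ring.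
have toV z : pts G z -> exists2 v, v \in verts G & D z = D (inl v).
  case: z => [v|[e t]] /=; first by exists v.
  case/andP=> eG t0l; have [sG _ l0] := wfG eG; exists (src G e) => //.
  rewrite -(pt0 G e) -(pt_inner t0l); apply: De => //; first by case/andP: t0l => ? ?; rewrite !ltW.
  by rewrite lexx ltW.
move=> /toV[u uG Dx] /toV[v vG Dy]; rewrite -/(D x) -/(D y) Dx Dy.
apply: (vconnected_eq (connected_vconnected cG) (c := D \o inl)) => // e eG /=.
have [_ _ l0] := wfG eG; rewrite -(pt0 G e) -(pt_len l0).
by apply: De => //; rewrite lexx ltW.
Qed.

Lemma pieces_retract x y e i : e \in edges (H i) ->
  pieces (H i) [:: ret i x; ret i y] e = pieces G [:: x; y] e.
Proof.
move=> eH; suff bE : breaks (H i) [:: ret i x; ret i y] e = breaks G [:: x; y] e.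
  by rewrite /pieces bE.
rewrite /breaks; have [_ _ _ ->] := sub_edge (retr i) eH; congr (sort _ (undup [:: _, _ & _])).
(* The retraction fixes the interior points of e and brings no other point into the interior of
   e. *)
have opt z : (match ret i z with inr (e', t) => if e' == e then Some t else None | inl _ => None end)
    = (match z with inr (e', t) => if e' == e then Some t else None | inl _ => None end).
  case: z => [v|[e' t]] //=; case: ifP => //= e'H.
  by case: eqP e'H => // ->; rewrite eH.
by rewrite /= !opt.
Qed.

Lemma resistance_pointed_sum x y : pts G x -> pts G y ->
  resistance G x y = \sum_(i < m) resistance (H i) (ret i x) (ret i y).
Proof.
move=> Gx Gy.
have /choice[f fP] : forall i, exists g, weak_unit_potential (H i) (ret i x) (ret i y) g.
  move=> i; have wfH : well_formed (H i) by case: (cH i).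
  have [k [z kz]] := exists_green wfH (connected_vconnected (cH i)) (connected_verts (cH i)).
  eexists; apply: (@pgreen_potential _ _ _ _ k) => //; first by exists z.
  - exact: retract_pts.
  - exact: retract_pts.
have GX : on_graph G [:: x; y] by move=> p; rewrite !inE => /orP[]/eqP->.
rewrite (@resistanceE _ _ _ _ _ _ (fun p => \sum_(i < m) f i (ret i p))); last first.
  move=> h; rewrite /dform sum_edges.
  have := sum_retract_const h Gx Gy => hxy.
  transitivity (\sum_(i < m) (h (ret i x) - h (ret i y))); last first.
    by rewrite sumrB; move: hxy; lra.
  apply: eq_bigr => i _; rewrite -fP; apply: eq_bigr => e eH.
  have [eG _ _ _] := sub_edge (retr i) eH; have [_ _ l0] := wfG eG.
  rewrite pieces_retract // big_seq [RHS]big_seq; apply: eq_bigr => st /mem_pieces[s1 s2].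
  have {}s1 := breaks_in_edge GX (ltW l0) s1; have {}s2 := breaks_in_edge GX (ltW l0) s2.
  (* On an edge of [H i] the other retractions are constant, so the glued potential drops exactly as
     its i-th summand does. *)
  rewrite !(sub_pt (retr i)) //; congr (_ * (_ / _)); rewrite -sumrB (bigD1 i) //=.
  rewrite big1 ?addr0 => [|j ji].
    by rewrite !(retract_pt_in (cH i) (retr i)).
  have eHj : e \notin edges (H j).
    have [k ek] := edgesH eG; move: eH; rewrite !ek => /eqP ik.
    by rewrite -ik.
  by rewrite !(retract_pt_out (retr j)) // subrr.
by rewrite -sumrB; apply: eq_bigr => i _; rewrite (resistanceE (fP i)).
Qed.

Section Invariants.
Variable q : gpoint R V E -> nat.
Hypothesis polG : polarized G q.
Local Notation qH i := (induced_q G q (H i)).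

Lemma piece_polarized i : polarized (H i) (qH i).
Proof.
have [P suppP] := exists_support_list polG.
exact: induced_polarized polG (cH i) (retr i) P suppP.
Qed.

Lemma piece_genus i : genus (H i) (qH i) = genus G q.
Proof.
have [P suppP] := exists_support_list polG.
exact: induced_genus polG (cH i) (retr i) P suppP.
Qed.

Lemma mean_resistance_pointed_sum x : pts G x ->
  mean_resistance G q x = \sum_(i < m) mean_resistance (H i) (qH i) (ret i x).
Proof.
move=> Gx; rewrite /mean_resistance.
rewrite (eq_gintegral _ wfG (fun y => @resistance_pointed_sum x y Gx)).
rewrite gintegral_sum //; last first.
- move=> i; apply: (edge_lipschitz_push (cH i) (retr i)).
  by apply: resistance_edge_lipschitz => //; exact: retract_pts.
- exact: admissible_atoms.
by apply: eq_bigr => i _; rewrite (gintegral_push polG (cH i) (retr i)).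
Qed.

Lemma gintegral_pointed_sum mu (f : 'I_m -> gpoint R V E -> R) g : finite_atoms G mu ->
  (forall i, edge_lipschitz (H i) (f i)) ->
  (forall x, pts G x -> g x = \sum_(i < m) f i (ret i x)) ->
  gintegral G mu g = \sum_(i < m) gintegral G mu (f i \o ret i).
Proof.
move=> fm fL gE; rewrite (eq_gintegral _ wfG gE) gintegral_sum // => i.
exact: (edge_lipschitz_push (cH i) (retr i)).
Qed.

Lemma tau_pointed_sum : tau G q = \sum_(i < m) tau (H i) (qH i).
Proof.
rewrite /tau (@gintegral_pointed_sum _ (fun i => mean_resistance (H i) (qH i))).
- rewrite mulr_sumr; apply: eq_bigr => i _.
  by rewrite -(gintegral_push polG (cH i) (retr i)).
- exact: admissible_atoms.
- by move=> i; apply: mean_resistance_lipschitz; exact: piece_polarized.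
- exact: mean_resistance_pointed_sum.
Qed.

Lemma green_diag_pointed_sum x : pts G x ->
  green_diag G q x = \sum_(i < m) green_diag (H i) (qH i) (ret i x).
Proof.
move=> Gx; rewrite /green_diag sumrB -tau_pointed_sum; congr (_ - _).
exact: mean_resistance_pointed_sum.
Qed.

Lemma green_diag_lipschitz i : edge_lipschitz (H i) (green_diag (H i) (qH i)).
Proof. by apply: edge_lipschitzB; apply: mean_resistance_lipschitz; exact: piece_polarized. Qed.

(** Common shape of epsilon, with (a, b) = (2g - 2, 1), and of the integral in phi, with (10g + 2,
    -1). All pieces have genus g, so the same a and b serve for G and for each of them. *)
Lemma gintegral_green (a b : R) :
  gintegral G (addm (scalem a (admissible G q)) (scalem b (delta_K G q))) (green_diag G q)
  = \sum_(i < m) gintegral (H i)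
      (addm (scalem a (admissible (H i) (qH i))) (scalem b (delta_K (H i) (qH i))))
      (green_diag (H i) (qH i)).
Proof.
have lin (X : mgraph R V E) q' f : polarized X q' ->
    gintegral X (addm (scalem a (admissible X q')) (scalem b (delta_K X q'))) f
    = a * gintegral X (admissible X q') f + b * gintegral X (delta_K X q') f.
  move=> pX; have fa := admissible_atoms pX; have fk := delta_K_atoms pX.
  by rewrite (gintegral_addm _ (finite_atoms_scale a fa) (finite_atoms_scale b fk))
    (gintegral_scalem _ _ fa) (gintegral_scalem _ _ fk).
have split_green mu : finite_atoms G mu -> gintegral G mu (green_diag G q)
    = \sum_(i < m) gintegral G mu (green_diag (H i) (qH i) \o ret i).
  move=> fmu; apply: gintegral_pointed_sum => //; first exact: green_diag_lipschitz.
  exact: green_diag_pointed_sum.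
rewrite (lin G q _ polG) (split_green _ (admissible_atoms polG)) (split_green _ (delta_K_atoms polG)).
rewrite !mulr_sumr -big_split; apply: eq_bigr => i _.
rewrite (lin (H i) (qH i) _ (piece_polarized i)) (gintegral_push polG (cH i) (retr i)).
by rewrite (gintegral_push_K polG (cH i) (retr i)).
Qed.

Lemma scale1m (mu : gmeasure R V E) : scalem 1 mu = mu.
Proof. by case: mu => a d; congr GMeasure; apply/funext => z /=; rewrite mul1r. Qed.

Lemma epsilon_pointed_sum : epsilon G q = \sum_(i < m) epsilon (H i) (qH i).
Proof.
rewrite /epsilon -[delta_K G q]scale1m gintegral_green.
by apply: eq_bigr => i _; rewrite piece_genus scale1m.
Qed.

Lemma phi_pointed_sum : phi G q = \sum_(i < m) phi (H i) (qH i).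
Proof.
rewrite /phi gintegral_green sum_total_length !mulr_sumr -sumrN -big_split.
by apply: eq_bigr => i _ /=; rewrite piece_genus.
Qed.

(** The coefficients of this combination of phi, epsilon and the length depend on g alone, which the
    pieces share with G. *)
Lemma lambda_pointed_sum : lambda G q = \sum_(i < m) lambda (H i) (qH i).
Proof.
rewrite /lambda phi_pointed_sum epsilon_pointed_sum sum_total_length.
rewrite -big_split !mulr_sumr -big_split.
by apply: eq_bigr => i _ /=; rewrite piece_genus.
Qed.

End Invariants.
End Additivity.

Theorem theorem4p3p2 (R : realType) (V E : finType)
    (G : mgraph R V E) (q : gpoint R V E -> nat)
    (m : nat) (H : 'I_m -> mgraph R V E)
    (polG : polarized G q) (genG : (1 <= genus G q)%N)
    (subH : forall i, subgraph (H i) G)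
    (connH : forall i, connected_mgraph (H i))
    (typeH : forall i, two_edge_connected G q (H i) \/ smooth_edge G q (H i))
    (sumH : successive_pointed_sum G H) :
  (forall i, polarized (H i) (induced_q G q (H i)) /\
             genus (H i) (induced_q G q (H i)) = genus G q) /\
  [/\ epsilon G q = \sum_(i < m) epsilon (H i) (induced_q G q (H i)),
      tau G q = \sum_(i < m) tau (H i) (induced_q G q (H i)),
      phi G q = \sum_(i < m) phi (H i) (induced_q G q (H i))
    & lambda G q = \sum_(i < m) lambda (H i) (induced_q G q (H i))].
Proof.
have [cG _ _] := polG; have wfG : well_formed G by case: cG.
have wfH i : well_formed (H i) by case: (connH i).
have [pi retr] := choice (fun i => pointed_sum_retraction wfG subH sumH i wfH).
have edgesH := pointed_sum_edges wfG subH sumH.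
split; first by move=> i; split; [exact: piece_polarized|exact: piece_genus].
split.
- exact: epsilon_pointed_sum.
- exact: tau_pointed_sum.
- exact: phi_pointed_sum.
- exact: lambda_pointed_sum.
Qed.
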